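(* Let $n\ge2$ and let $\mathcal{P}$ be a diagonal $n\times n$ matrix pencil whose diagonal entries are $x_k\mu+\lambda$ ($k=1,\dots,n$, $x_k\in\mathbb{C}$), with $l\ge2$ distinct eigenvalues among the $x_k$, whose multiplicities (numbers of occurrences) $m_1\ge m_2\ge\dots\ge m_l$ are sorted in descending order. Let $|\psi\rangle\in\mathbb{C}^2\otimes\mathbb{C}^n\otimes\mathbb{C}^n$ be the state corresponding to $\mathcal{P}$ and $\mathcal{C}=G|\psi\rangle$ its SLOCC class. Then: (i) if $m_1>\sum_{i=2}^l m_i$, then $\mathcal{C}$ is in the null-cone; (ii) if $l=2$ and $m_1=m_2$, then $\mathcal{C}$ is strictly polystable, except when $n=2$, in which case $\mathcal{C}$ is stable; (iii) if $l>2$ and $m_1=\sum_{i=2}^l m_i$, then $\mathcal{C}$ is strictly semistable; (iv) otherwise, i.e. if $l>2$ and $m_1<\sum_{i=2}^l m_i$, $\mathcal{C}$ is polystable; moreover $\mathcal{C}$ is stable if and only if all eigenvalues are distinct ($l=n$), and strictly polystable if and only if $l<n$.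
   Context: $G=SL(2,\mathbb{C})\times SL(n,\mathbb{C})\times SL(n,\mathbb{C})$ acts on $\mathbb{C}^2\otimes\mathbb{C}^n\otimes\mathbb{C}^n$ by $A\otimes B\otimes C$ and on the projective space by $g[\psi]=[g|\psi\rangle]$. To a pencil $\mathcal{P}=\mu R+\lambda S$ ($R,S$ complex $n\times n$ matrices, $\lambda,\mu$ formal variables) corresponds the state $|0\rangle\sum_{j,k}R_{jk}|j\rangle|k\rangle+|1\rangle\sum_{j,k}S_{jk}|j\rangle|k\rangle$; for the diagonal pencil above, $R=\mathrm{diag}(x_1,\dots,x_n)$, $S=\mathbb{1}$. The null-cone is the set of vectors $|\phi\rangle$ with $0\in\overline{G|\phi\rangle}$ (standard topology); vectors outside it are semistable. A semistable vector is polystable if its orbit $G|\phi\rangle$ is closed; a polystable vector is stable if the complex dimension of its projective orbit $G[\phi]$ equals the maximal dimension among all orbits of polystable vectors, and strictly polystable otherwise; a semistable vector that is not polystable is strictly semistable. A class is said to have a property if its elements do. *)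

(* Defs.v *)
From HB Require Import structures.
From mathcomp Require Import all_boot all_order all_algebra.
From mathcomp Require Import reals.
From mathcomp.real_closed Require Export complex.
Set Implicit Arguments. Unset Strict Implicit. Unset Printing Implicit Defensive.
Import Order.TTheory GRing.Theory Num.Theory.
Local Open Scope ring_scope.

Section Defs.
Variables (R : realType) (n : nat).
Local Notation C := (R[i])%C.

(* A vector of C^2 ⊗ C^n ⊗ C^n, written |0> ⊗ P + |1> ⊗ Q,
   i.e. (P, Q) with P j k = coefficient of |0>|j>|k>, Q j k = of |1>|j>|k>. *)
Definition state := ('M[C]_n * 'M[C]_n)%type.

Definition act (A : 'M[C]_2) (B D : 'M[C]_n) (s : state) : state :=
  (A 0 0 *: (B *m s.1 *m D^T) + A 0 1 *: (B *m s.2 *m D^T),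
   A 1 0 *: (B *m s.1 *m D^T) + A 1 1 *: (B *m s.2 *m D^T)).

Definition inG (A : 'M[C]_2) (B D : 'M[C]_n) : Prop :=
  \det A = 1 /\ \det B = 1 /\ \det D = 1.

Definition sqnorm (s : state) : C :=
  \sum_(j < n) \sum_(k < n) (`|s.1 j k| ^+ 2 + `|s.2 j k| ^+ 2).

Definition sub_state (s t : state) : state := (s.1 - t.1, s.2 - t.2).

Definition in_orbit_closure (s phi : state) : Prop :=
  forall e : C, 0 < e -> exists A B D, inG A B D /\ sqnorm (sub_state (act A B D s) phi) < e.

Definition in_orbit (s phi : state) : Prop :=
  exists A B D, inG A B D /\ act A B D s = phi.

Definition zero_state : state := (0, 0).

Definition nullcone (s : state) : Prop := in_orbit_closure s zero_state.
Definition semistable (s : state) : Prop := ~ nullcone s.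
Definition orbit_closed (s : state) : Prop :=
  forall phi, in_orbit_closure s phi -> in_orbit s phi.
Definition polystable (s : state) : Prop := semistable s /\ orbit_closed s.

Definition svec (s : state) : 'rV[C]_(n * n + n * n) := row_mx (mxvec s.1) (mxvec s.2).

Definition dact1 (X : 'M[C]_2) (s : state) : state :=
  (X 0 0 *: s.1 + X 0 1 *: s.2, X 1 0 *: s.1 + X 1 1 *: s.2).
Definition dact2 (Y : 'M[C]_n) (s : state) : state := (Y *m s.1, Y *m s.2).
Definition dact3 (Z : 'M[C]_n) (s : state) : state := (s.1 *m Z^T, s.2 *m Z^T).

(* Complex dimension of the projective orbit G[s]:
   dim_C (T_s (G s) + C s) - 1, where T_s (G s) = sl_2.s + sl_n.s + sl_n.s is the
   tangent space of the affine orbit at s.  Since gl = sl + C.1 and the identity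
   of each factor acts by s -> s, the span of gl_2.s + gl_n.s + gl_n.s (spanned by
   the images of the elementary matrices) equals T_s(G s) + C s. *)
Definition proj_orbit_dim (s : state) : nat :=
  (\rank ((\sum_(p : 'I_2 * 'I_2) <<svec (dact1 (delta_mx p.1 p.2) s)>>)
        + (\sum_(p : 'I_n * 'I_n) <<svec (dact2 (delta_mx p.1 p.2) s)>>)
        + (\sum_(p : 'I_n * 'I_n) <<svec (dact3 (delta_mx p.1 p.2) s)>>))%MS).-1.

Definition stable (s : state) : Prop :=
  polystable s /\ forall phi, polystable phi -> (proj_orbit_dim phi <= proj_orbit_dim s)%N.
Definition strictly_polystable (s : state) : Prop := polystable s /\ ~ stable s.
Definition strictly_semistable (s : state) : Prop := semistable s /\ ~ polystable s.

(* The state of the diagonal pencil mu R + lambda S, R = diag(x), S = 1. *)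
Definition pencil_state (x : 'I_n -> C) : state :=
  (diag_mx (\row_k x k), 1%:M).

Definition eigvals (x : 'I_n -> C) : seq C := undup [seq x k | k <- enum 'I_n].
Definition mults (x : 'I_n -> C) : seq nat :=
  sort geq [seq #|[set k | x k == v]| | v <- eigvals x].

End Defs.

(* Main.v *)
(* An element (A, B, D) turns the determinant form of the pencil into
   prod_k (w_k1 mu + w_k2 lambda) with w_k = A (x_k, 1)^T.  As long as no eigenvalue
   has multiplicity above n/2, prod_k |w_k| >= c |A|^(n - 2m) for the multiplicity m
   of some eigenvalue, because all w_k except those of a single eigenvalue have size
   comparable to |A|, and these at least 1/|A|.  A product of linear forms controls
   the product of their norms, so this bounds det away from 0 (semistability) and,
   when 2m < n for all eigenvalues, bounds A along any sequence converging in the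
   closure of the orbit.  For two eigenvalues of equal multiplicity A is first
   balanced by a torus in the stabilizer.  Once A converges, undoing it reduces the
   closedness of the orbit to the closedness of the conjugacy class of a
   diagonalizable matrix.  Diagonal one-parameter subgroups produce the limits that
   show cases (i) and (iii).

   The tangent space to the orbit has dimension 4 + 2n^2 minus that of the stabilizer
   in gl_2 + gl_n + gl_n.  By perturbation towards a generic pencil, every stabilizer
   has dimension at least n + 1; for n >= 3 this is attained by pencils with distinct
   eigenvalues, while a repeated eigenvalue increases it. *)
Require Import Defs.
From HB Require Import structures.
From mathcomp Require Import all_boot all_order all_algebra.
From mathcomp Require Import perm interval_inference ring lra zify.
From mathcomp Require Import boolp classical_sets filter topology normedtype.
From mathcomp Require Import reals.
From mathcomp.real_closed Require Import complex.
Set Implicit Arguments. Unset Strict Implicit. Unset Printing Implicit Defensive.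
Import Order.TTheory GRing.Theory Num.Theory.
Import numFieldNormedType.Exports.
Local Open Scope ring_scope.

(** * Function rings closed under the operations of matrix algebra *)

Section FunSubring.
Variables (T : Type) (K : comUnitRingType) (S : (T -> K) -> Prop).

(** Two instances matter: polynomial functions of a parameter, and sequences with a limit along an
    ultrafilter. Both need the same fact, that determinants, adjugates, products and powers of
    matrices over the subring stay over it. *)
Definition fun_subring :=
  [/\ forall c, S (fun=> c),
      forall f g, S f -> S g -> S (fun t => f t + g t)
    & forall f g, S f -> S g -> S (fun t => f t * g t)].

Definition mx_in m n (F : T -> 'M[K]_(m, n)) :=
  forall i j, S (fun t => F t i j).

Hypothesis HS : fun_subring.

Lemma subring_cst c : S (fun=> c). Proof. by case: HS. Qed.
Lemma subringD f g : S f -> S g -> S (fun t => f t + g t).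
Proof. by case: HS => _ + _; apply. Qed.
Lemma subringM f g : S f -> S g -> S (fun t => f t * g t).
Proof. by case: HS => _ _; apply. Qed.

Lemma subringN f : S f -> S (fun t => - f t).
Proof.
move=> Sf; rewrite (_ : (fun t => - f t) = (fun t => -1 * f t)).
  by apply: subringM => //; apply: subring_cst.
by apply: funext => t; rewrite mulN1r.
Qed.

Lemma subring_sum I (r : seq I) (P : pred I) (f : I -> T -> K) :
  (forall i, S (f i)) -> S (fun t => \sum_(i <- r | P i) f i t).
Proof.
move=> Sf; elim: r => [|i r IH].
  rewrite (_ : (fun _ => _) = fun=> 0); first exact: subring_cst.
  by apply: funext => t; rewrite big_nil.
rewrite (_ : (fun _ => _) =
  (fun t => (if P i then f i t else 0) + \sum_(j <- r | P j) f j t)).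
  by apply: subringD => //; case: (P i) => //; apply: subring_cst.
by apply: funext => t; rewrite big_cons; case: ifP => //; rewrite add0r.
Qed.

Lemma subring_prod I (r : seq I) (P : pred I) (f : I -> T -> K) :
  (forall i, S (f i)) -> S (fun t => \prod_(i <- r | P i) f i t).
Proof.
move=> Sf; elim: r => [|i r IH].
  rewrite (_ : (fun _ => _) = fun=> 1); first exact: subring_cst.
  by apply: funext => t; rewrite big_nil.
rewrite (_ : (fun _ => _) =
  (fun t => (if P i then f i t else 1) * \prod_(j <- r | P j) f j t)).
  by apply: subringM => //; case: (P i) => //; apply: subring_cst.
by apply: funext => t; rewrite big_cons; case: ifP => //; rewrite mul1r.
Qed.

Lemma subring_det n (F : T -> 'M[K]_n) : mx_in F -> S (fun t => \det (F t)).
Proof.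
move=> SF; apply: subring_sum => s; apply: subringM; first exact: subring_cst.
by apply: subring_prod.
Qed.

Lemma mx_in_cst m n (A : 'M[K]_(m, n)) : mx_in (fun=> A).
Proof. by move=> i j; apply: subring_cst. Qed.

Lemma mx_inD m n (F G : T -> 'M[K]_(m, n)) :
  mx_in F -> mx_in G -> mx_in (fun t => F t + G t).
Proof.
move=> SF SG i j; rewrite (_ : (fun t => _) = (fun t => F t i j + G t i j)).
  exact: subringD.
by apply: funext => t; rewrite mxE.
Qed.

Lemma mx_inZ m n (f : T -> K) (F : T -> 'M[K]_(m, n)) :
  S f -> mx_in F -> mx_in (fun t => f t *: F t).
Proof.
move=> Sf SF i j; rewrite (_ : (fun t => _) = (fun t => f t * F t i j)).
  exact: subringM.
by apply: funext => t; rewrite mxE.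
Qed.

Lemma mx_inM m n p (F : T -> 'M[K]_(m, n)) (G : T -> 'M[K]_(n, p)) :
  mx_in F -> mx_in G -> mx_in (fun t => F t *m G t).
Proof.
move=> SF SG i j.
rewrite (_ : (fun t => _) = (fun t => \sum_k F t i k * G t k j)).
  by apply: subring_sum => k; apply: subringM.
by apply: funext => t; rewrite mxE.
Qed.

Lemma mx_in_adj n (F : T -> 'M[K]_n) : mx_in F -> mx_in (fun t => \adj (F t)).
Proof.
move=> SF i j; rewrite (_ : (fun t => _) = (fun t => cofactor (F t) j i)).
  apply: subringM; first exact: subring_cst.
  apply: subring_det => k l; rewrite (_ : (fun t => _) =
    (fun t => F t (lift j k) (lift i l))) //.
  by apply: funext => t; rewrite !mxE.
by apply: funext => t; rewrite mxE.
Qed.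

Lemma mx_in_prod n I (r : seq I) (F : I -> T -> 'M[K]_n.+1) :
  (forall i, mx_in (F i)) -> mx_in (fun t => \prod_(i <- r) F i t).
Proof.
move=> SF; elim: r => [|i r IH].
  rewrite (_ : (fun _ => _) = fun=> 1); first exact: mx_in_cst.
  by apply: funext => t; rewrite big_nil.
rewrite (_ : (fun _ => _) = (fun t => F i t *m \prod_(j <- r) F j t)).
  exact: mx_inM.
by apply: funext => t; rewrite big_cons.
Qed.

Lemma mx_inX n (F : T -> 'M[K]_n.+1) k :
  mx_in F -> mx_in (fun t => F t ^+ k).
Proof.
move=> SF; rewrite (_ : (fun _ => _) = (fun t => \prod_(i <- iota 0 k) F t)).
  exact: mx_in_prod.
by apply: funext => t; rewrite big_const_seq count_predT size_iota iter_mulr_1.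
Qed.

End FunSubring.

(** * Dimension of the orbits *)

Section OrbitDimension.
Variable F : fieldType.

Section TangentMap.
Variable n : nat.
Implicit Types s t : 'M[F]_n * 'M[F]_n.

(* At F = R[i] these unfold to [svec] and to [dact1], [dact2], [dact3]. *)
Definition pencil_vec s : 'rV[F]_(n * n + n * n) := row_mx (mxvec s.1) (mxvec s.2).
Definition inf_act1 (X : 'M[F]_2) s :=
  (X 0 0 *: s.1 + X 0 1 *: s.2, X 1 0 *: s.1 + X 1 1 *: s.2).
Definition inf_act2 (Y : 'M[F]_n) s := (Y *m s.1, Y *m s.2).
Definition inf_act3 (Z : 'M[F]_n) s := (s.1 *m Z^T, s.2 *m Z^T).

Lemma pencil_vec_linear a s t :
  pencil_vec (a *: s.1 + t.1, a *: s.2 + t.2) = a *: pencil_vec s + pencil_vec t.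
Proof. by rewrite /pencil_vec /= !linearP /= scale_row_mx add_row_mx. Qed.

Lemma inf_act1_linear s : linear (fun X : 'M[F]_2 => pencil_vec (inf_act1 X s)).
Proof.
move=> a X Y; rewrite -pencil_vec_linear /=; congr pencil_vec.
by congr pair; rewrite !mxE !scalerDl scalerDr !scalerA addrACA.
Qed.

Lemma inf_act2_linear s : linear (fun X : 'M[F]_n => pencil_vec (inf_act2 X s)).
Proof.
move=> a X Y; rewrite -pencil_vec_linear /=; congr pencil_vec.
by congr pair; rewrite mulmxDl scalemxAl.
Qed.

Lemma inf_act3_linear s : linear (fun X : 'M[F]_n => pencil_vec (inf_act3 X s)).
Proof.
move=> a X Y; rewrite -pencil_vec_linear /=; congr pencil_vec.
by congr pair; rewrite linearP /= mulmxDr scalemxAr.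
Qed.

Definition pencil_vec1 s X := pencil_vec (inf_act1 X s).
Definition pencil_vec2 s Y := pencil_vec (inf_act2 Y s).
Definition pencil_vec3 s Z := pencil_vec (inf_act3 Z s).

HB.instance Definition _ s :=
  GRing.isLinear.Build F 'M[F]_2 _ _ (pencil_vec1 s) (inf_act1_linear s).
HB.instance Definition _ s :=
  GRing.isLinear.Build F 'M[F]_n _ _ (pencil_vec2 s) (inf_act2_linear s).
HB.instance Definition _ s :=
  GRing.isLinear.Build F 'M[F]_n _ _ (pencil_vec3 s) (inf_act3_linear s).

Local Notation N := (2 * 2 + (n * n + n * n))%N.

Definition gl_row (X : 'M[F]_2) (Y Z : 'M[F]_n) : 'rV[F]_N :=
  row_mx (mxvec X) (row_mx (mxvec Y) (mxvec Z)).

Lemma gl_rowP (u : 'rV[F]_N) : exists X Y Z, u = gl_row X Y Z.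
Proof.
exists (vec_mx (lsubmx u)), (vec_mx (lsubmx (rsubmx u))),
  (vec_mx (rsubmx (rsubmx u))).
by rewrite /gl_row !vec_mxK !hsubmxK.
Qed.

(** The infinitesimal action of gl_2 + gl_n + gl_n at [s], acting on row vectors: its row space is
    the tangent space of the orbit of the cone over [s], its left kernel the stabilizer. *)
Definition tangent_mx s : 'M[F]_(N, n * n + n * n) :=
  col_mx (lin1_mx (pencil_vec1 s \o vec_mx))
 (col_mx (lin1_mx (pencil_vec2 s \o vec_mx))
         (lin1_mx (pencil_vec3 s \o vec_mx))).

Lemma gl_row_tangent s X Y Z : gl_row X Y Z *m tangent_mx s =
  pencil_vec (inf_act1 X s) + (pencil_vec (inf_act2 Y s) + pencil_vec (inf_act3 Z s)).
Proof.
by rewrite /gl_row /tangent_mx !mul_row_col !mul_rV_lin1 /= !mxvecK.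
Qed.

Opaque tangent_mx.

Lemma pencil_vec_0 : pencil_vec (0, 0) = 0 :> 'rV[F]_(n * n + n * n).
Proof. by rewrite /pencil_vec /= !linear0 row_mx0. Qed.

Lemma pencil_vec_inj s t : pencil_vec s = pencil_vec t -> s = t.
Proof.
case: s t => [P Q] [P' Q'] /eq_row_mx /= [].
by move=> /(can_inj mxvecK) -> /(can_inj mxvecK) ->.
Qed.

Lemma gl_row_tangentE s X Y Z : gl_row X Y Z *m tangent_mx s =
  pencil_vec (X 0 0 *: s.1 + X 0 1 *: s.2 + (Y *m s.1 + s.1 *m Z^T),
        X 1 0 *: s.1 + X 1 1 *: s.2 + (Y *m s.2 + s.2 *m Z^T)).
Proof.
rewrite gl_row_tangent.
have pvD a b : pencil_vec a + pencil_vec b =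
    pencil_vec (a.1 + b.1, a.2 + b.2) :> 'rV[F]_(n * n + n * n).
  by have := pencil_vec_linear 1 a b; rewrite !scale1r => ->.
by rewrite !pvD.
Qed.

Lemma mulmx_sum_delta m k p (f : {linear 'M[F]_(m, k) -> 'rV[F]_p}) X :
  (f X <= \sum_(q : 'I_m * 'I_k) <<f (delta_mx q.1 q.2)>>)%MS.
Proof.
rewrite [X in f X]matrix_sum_delta linear_sum; apply: summx_sub => i _ /=.
rewrite linear_sum; apply: summx_sub => j _ /=; rewrite linearZ scalemx_sub //.
by rewrite (sumsmx_sup (i, j)) //= genmxE.
Qed.

(** Connects the matrix with the span in the definition of the orbit dimension. The two spaces
    coincide: a Lie algebra element splits into its three components, and each elementary generator
    is an element with a single nonzero component. *)
Lemma rank_tangentE s : \rank (tangent_mx s) = \rank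
  ((\sum_(p : 'I_2 * 'I_2) <<pencil_vec1 s (delta_mx p.1 p.2)>>)
 + (\sum_(p : 'I_n * 'I_n) <<pencil_vec2 s (delta_mx p.1 p.2)>>)
 + (\sum_(p : 'I_n * 'I_n) <<pencil_vec3 s (delta_mx p.1 p.2)>>))%MS.
Proof.
apply/esym/eqmx_rank.
apply/andP; split; last first.
  apply/row_subP => i; rewrite rowE.
  have [X [Y [Z ->]]] := gl_rowP (delta_mx 0 i).
  rewrite gl_row_tangent addrA !addmx_sub_adds //.
  - exact: (mulmx_sum_delta (pencil_vec1 s)).
  - exact: (mulmx_sum_delta (pencil_vec2 s)).
  - exact: (mulmx_sum_delta (pencil_vec3 s)).
rewrite !addsmx_sub -andbA; apply/and3P; split;
  apply/sumsmx_subP => p _; rewrite genmxE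
  ?/pencil_vec1 ?/pencil_vec2 ?/pencil_vec3.
- have := gl_row_tangent s (delta_mx p.1 p.2) 0 0.
  have -> : inf_act2 0 s = (0, 0) by rewrite /inf_act2 !mul0mx.
  have -> : inf_act3 0 s = (0, 0) by rewrite /inf_act3 trmx0 !mulmx0.
  by rewrite pencil_vec_0 !addr0 => <-; apply: submxMl.
- have := gl_row_tangent s 0 (delta_mx p.1 p.2) 0.
  have -> : inf_act1 0 s = (0, 0) by rewrite /inf_act1 !mxE !scale0r !addr0.
  have -> : inf_act3 0 s = (0, 0) by rewrite /inf_act3 trmx0 !mulmx0.
  by rewrite pencil_vec_0 add0r addr0 => <-; apply: submxMl.
- have := gl_row_tangent s 0 0 (delta_mx p.1 p.2).
  have -> : inf_act1 0 s = (0, 0) by rewrite /inf_act1 !mxE !scale0r !addr0.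
  have -> : inf_act2 0 s = (0, 0) by rewrite /inf_act2 !mul0mx.
  by rewrite pencil_vec_0 !add0r => <-; apply: submxMl.
Qed.

(* Besides the given pairs (Y, Z), the pair of scalars (1, -1) of the first two
   factors always lies in the stabilizer. *)
Lemma rank_tangent_le s m (Ys : 'M[F]_(m, n * n)) :
    row_free Ys ->
    (forall k, exists Z, vec_mx (row k Ys) *m s.1 + s.1 *m Z = 0 /\
                         vec_mx (row k Ys) *m s.2 + s.2 *m Z = 0) ->
  (\rank (tangent_mx s) + m.+1 <= N)%N.
Proof.
move=> freeY /choice[Zs HZ].
pose Zm := \matrix_k mxvec (Zs k)^T.
pose K : 'M[F]_(m + 1, N) :=
  col_mx (row_mx 0 (row_mx Ys Zm)) (gl_row 1%:M (- 1%:M) 0).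
have KV : K *m tangent_mx s = 0.
  have E1 : gl_row 1%:M (- 1%:M) 0 *m tangent_mx s = 0.
    rewrite gl_row_tangentE trmx0 !mulmx0 !addr0 !mxE /= !scale0r !scale1r.
    by rewrite !mulNmx !mul1mx addr0 add0r !subrr pencil_vec_0.
  have E2 : row_mx 0 (row_mx Ys Zm) *m tangent_mx s = 0.
    apply/row_matrixP => k; rewrite row_mul !row_row_mx rowK row0 row0.
    have -> : row_mx 0 (row_mx (row k Ys) (mxvec (Zs k)^T)) =
      gl_row 0 (vec_mx (row k Ys)) (Zs k)^T by rewrite /gl_row linear0 vec_mxK.
    rewrite gl_row_tangentE trmxK.
    by have [-> ->] := HZ k; rewrite !mxE !scale0r !addr0 pencil_vec_0.
  by rewrite /K mul_col_mx E1 E2 col_mx0.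
(* Only the last row of [K] has a nonzero gl_2 block, so that block isolates its coefficient. *)
have freeK : row_free K.
  apply: inj_row_free => u; rewrite -[u]hsubmxK mul_row_col.
  set a := lsubmx u; set b := rsubmx u; rewrite [b]mx11_scalar mul_scalar_mx.
  rewrite /gl_row !scale_row_mx !mul_mx_row mulmx0 !add_row_mx add0r.
  rewrite -[X in _ = X]row_mx0 => /eq_row_mx[] /eqP.
  rewrite scaler_eq0 => /orP[/eqP b0|/eqP]; last first.
    rewrite -(linear0 (mxvec : 'M_2 -> _)) => /(can_inj mxvecK).
    by move=> /matrixP/(_ 0 0)/eqP; rewrite !mxE oner_eq0.
  rewrite b0 !scale0r !addr0 -[X in _ = X]row_mx0 => /eq_row_mx[].
  rewrite -[X in _ = X -> _](mul0mx _ Ys) => /(row_free_inj freeY) -> _.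
  by rewrite raddf0 row_mx0.
have := mulmx0_rank_max KV; rewrite (eqP freeK); lia.
Qed.

(** If [k] linear conditions single out 0 in the stabilizer, the stabilizer has dimension at most
    [k]. *)
Lemma rank_tangent_ge s k (E : 'M[F]_(N, k)) :
    (forall u : 'rV[F]_N, u *m tangent_mx s = 0 -> u *m E = 0 -> u = 0) ->
  (N <= \rank (tangent_mx s) + k)%N.
Proof.
move=> inj; have : row_free (row_mx (tangent_mx s) E).
  apply: inj_row_free => u; rewrite mul_mx_row -[X in _ = X -> _]row_mx0.
  by case/eq_row_mx; apply: inj.
rewrite -row_leq_rank => /leq_trans; apply.
rewrite -mxrank_tr tr_row_mx -addsmxE.
apply: (leq_trans (mxrank_adds_leqif _ _)).
by rewrite !mxrank_tr leq_add2l rank_leq_col.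
Qed.

(** Makes the tangent matrix a polynomial function along a line of states, as the perturbation
    argument requires. *)
Lemma tangent_mx_linear a b s t :
  tangent_mx (a *: s.1 + b *: t.1, a *: s.2 + b *: t.2) =
  a *: tangent_mx s + b *: tangent_mx t.
Proof.
apply/row_matrixP => i; rewrite !rowE.
have [X [Y [Z ->]]] := gl_rowP (delta_mx 0 i).
rewrite mulmxDr -!scalemxAr !gl_row_tangentE.
rewrite -[b *: pencil_vec _]addr0 -pencil_vec_0 -!pencil_vec_linear.
rewrite /= !addr0; congr (pencil_vec (_, _));
  rewrite !mulmxDr !mulmxDl -!scalemxAl -!scalemxAr;
  by apply/matrixP => p q; rewrite !mxE; ring.
Qed.

End TangentMap.

Lemma ord2_ind (P : 'I_2 -> Prop) : P 0 -> P 1 -> forall i, P i.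
Proof.
move=> P0 P1 [[|[|//]] lti]; first by rewrite (_ : Ordinal _ = 0) //; apply: val_inj.
by rewrite (_ : Ordinal _ = 1) //; apply: val_inj.
Qed.

(** * Stabilizers of diagonal pencils *)

Section PencilOrbit.
Local Notation pencil_state x := (diag_mx (\row_k x k), 1%:M).
Variables (n : nat) (x : 'I_n -> F).
Local Notation N := (2 * 2 + (n * n + n * n))%N.

(** The equations decouple: each pair (i, j) involves only [Y i j], [Z j i] and, on the diagonal,
    [X]. *)
Lemma pencil_stabilizer X Y Z : gl_row X Y Z *m tangent_mx (pencil_state x) = 0 ->
  forall i j,
    (i == j)%:R * (X 0 0 * x i + X 0 1) + Y i j * x j + x i * Z j i = 0 /\
    (i == j)%:R * (X 1 0 * x i + X 1 1) + Y i j + Z j i = 0.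
Proof.
rewrite gl_row_tangentE -pencil_vec_0 => /pencil_vec_inj[/matrixP e1 /matrixP e2] i j.
move/(_ i j): e1; move/(_ i j): e2; rewrite /= mulmx1 mul1mx mul_mx_diag mul_diag_mx.
rewrite !mxE; case: (i == j); rewrite ?mulr1n ?mulr0n => e2 e1.
  by split; [rewrite -[RHS]e1|rewrite -[RHS]e2]; ring.
by split; [rewrite -[RHS]e1|rewrite -[RHS]e2]; ring.
Qed.

Lemma mulf_eq0r (a b : F) : a != 0 -> a * b = 0 -> b = 0.
Proof. by move=> a0 /eqP; rewrite mulf_eq0 (negPf a0) => /eqP. Qed.

(** Divided differences eliminate first [a], then [b]. *)
Lemma quadratic3_eq0 (a b c x1 x2 x3 : F) :
    x1 != x2 -> x1 != x3 -> x2 != x3 ->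
    a + b * x1 + c * x1 ^+ 2 = 0 -> a + b * x2 + c * x2 ^+ 2 = 0 ->
    a + b * x3 + c * x3 ^+ 2 = 0 ->
  [/\ a = 0, b = 0 & c = 0].
Proof.
rewrite -!(subr_eq0 x1) -(subr_eq0 x2) => n12 n13 n23 e1 e2 e3.
have e12 : b + c * (x1 + x2) = 0.
  apply: (mulf_eq0r n12).
  transitivity ((a + b * x1 + c * x1 ^+ 2) - (a + b * x2 + c * x2 ^+ 2)); first by ring.
  by rewrite e1 e2 subrr.
have e13 : b + c * (x1 + x3) = 0.
  apply: (mulf_eq0r n13).
  transitivity ((a + b * x1 + c * x1 ^+ 2) - (a + b * x3 + c * x3 ^+ 2)); first by ring.
  by rewrite e1 e3 subrr.
have c0 : c = 0.
  apply: (mulf_eq0r n23).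
  transitivity ((b + c * (x1 + x2)) - (b + c * (x1 + x3))); first by ring.
  by rewrite e12 e13 subrr.
have b0 : b = 0 by rewrite -e12 c0 mul0r addr0.
by move: e1; rewrite c0 b0 !mul0r !addr0.
Qed.

(** Distinct eigenvalues force [Y] and [Z] to be diagonal up to entries that vanish. The n + 1
    conditions in [f] kill the diagonal of [Y] and [X 0 0]; eliminating [Z i i] then leaves a
    quadratic polynomial in [x i] with coefficients from [X], which has three roots. *)
Lemma rank_pencil_inj (i1 i2 i3 : 'I_n) : injective x ->
    i1 != i2 -> i1 != i3 -> i2 != i3 ->
  (N <= \rank (tangent_mx (pencil_state x)) + n.+1)%N.
Proof.
move=> xinj n12 n13 n23; rewrite -[n.+1]addn1.
pose f (u : 'rV[F]_N) : 'rV[F]_(n + 1) :=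
  row_mx (\row_i vec_mx (lsubmx (rsubmx u)) i i) (const_mx (vec_mx (lsubmx u) 0 0)).
have f_lin : linear f.
  move=> a u v; rewrite /f !linearP /= scale_row_mx add_row_mx.
  by congr row_mx; apply/matrixP => i j; rewrite !mxE.
pose fl := GRing.isLinear.Build _ _ _ _ f f_lin.
pose fL : {linear _ -> _} := HB.pack f fl.
apply: (rank_tangent_ge (E := lin1_mx fL)) => u.
have [X [Y [Z ->]]] := gl_rowP u.
move=> /pencil_stabilizer H; rewrite mul_rV_lin1 /= /f /gl_row.
rewrite !(row_mxKl, row_mxKr) !mxvecK -row_mx0 => /eq_row_mx[/rowP Y0 /rowP/(_ 0)].
rewrite !mxE => X00.
have offdiag i j : i != j -> Y i j = 0 /\ Z j i = 0.
  move=> nij; have [] := H i j; rewrite (negPf nij) !mul0r !add0r => e1 e2.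
  have xij : x i - x j != 0 by rewrite subr_eq0 (inj_eq xinj).
  have Yij : Y i j = 0.
    apply: (mulf_eq0r xij); transitivity (x i * (Y i j + Z j i) - (Y i j * x j + x i * Z j i)).
      by ring.
    by rewrite e1 e2 mulr0 subr0.
  by split=> //; rewrite -[RHS]e2 Yij add0r.
have diag i : X 0 1 + (- X 1 1) * x i + (- X 1 0) * x i ^+ 2 = 0 /\
    Z i i = - (X 1 0 * x i + X 1 1).
  have := H i i; rewrite eqxx !mul1r X00; have := Y0 i; rewrite !mxE => -> [e1 e2].
  have -> : Z i i = - (X 1 0 * x i + X 1 1).
    by rewrite -[RHS]add0r -[X in X + _]e2; ring.
  split=> //; transitivity ((0 * x i + X 0 1 + 0 * x i + x i * Z i i) -
    x i * (X 1 0 * x i + X 1 1 + 0 + Z i i)); first by ring.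
  by rewrite e1 e2 mulr0 subr0.
have [] := @quadratic3_eq0 (X 0 1) (- X 1 1) (- X 1 0) (x i1) (x i2) (x i3).
- by rewrite (inj_eq xinj).
- by rewrite (inj_eq xinj).
- by rewrite (inj_eq xinj).
- by have [] := diag i1.
- by have [] := diag i2.
- by have [] := diag i3.
move=> X01 /eqP; rewrite oppr_eq0 => /eqP X11 /eqP; rewrite oppr_eq0 => /eqP X10.
have -> : X = 0.
  apply/matrixP => i j; rewrite mxE.
  by elim/ord2_ind: i; elim/ord2_ind: j.
have -> : Y = 0.
  apply/matrixP => i j; rewrite mxE; have [<-|/offdiag[]//] := eqVneq i j.
  by have := Y0 i; rewrite !mxE.
have -> : Z = 0.
  apply/matrixP => i j; rewrite mxE; have [<-|] := eqVneq i j.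
    by have [_ ->] := diag i; rewrite X10 X11 mul0r addr0 oppr0.
  by rewrite eq_sym => /offdiag[].
by rewrite /gl_row !linear0 !row_mx0.
Qed.

(** Two eigenvalues are too few roots for a quadratic, so [f] also kills [X 1 0]; what remains is
    affine in [x i] and is determined by two points. *)
Lemma rank_pencil_inj2 (i1 i2 : 'I_n) : n = 2%N -> injective x -> i1 != i2 ->
  (N <= \rank (tangent_mx (pencil_state x)) + n.+2)%N.
Proof.
move=> n2 xinj n12; rewrite -[n.+2]addn2.
pose f (u : 'rV[F]_N) : 'rV[F]_(n + 2) :=
  row_mx (\row_i vec_mx (lsubmx (rsubmx u)) i i) (\row_i vec_mx (lsubmx u) i 0).
have f_lin : linear f.
  move=> a u v; rewrite /f !linearP /= scale_row_mx add_row_mx.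
  by congr row_mx; apply/matrixP => i j; rewrite !mxE.
pose fl := GRing.isLinear.Build _ _ _ _ f f_lin.
pose fL : {linear _ -> _} := HB.pack f fl.
apply: (rank_tangent_ge (E := lin1_mx fL)) => u.
have [X [Y [Z ->]]] := gl_rowP u.
move=> /pencil_stabilizer H; rewrite mul_rV_lin1 /= /f /gl_row.
rewrite !(row_mxKl, row_mxKr) !mxvecK -row_mx0 => /eq_row_mx[/rowP Y0 /rowP X0].
have X00 : X 0 0 = 0 by have := X0 0; rewrite !mxE.
have X10 : X 1 0 = 0 by have := X0 1; rewrite !mxE.
have x12 : x i1 - x i2 != 0 by rewrite subr_eq0 (inj_eq xinj).
have [Zoff Xdiag] : (forall i j, i != j -> Y i j = 0 /\ Z j i = 0) /\
    forall i, X 0 1 = X 1 1 * x i /\ Z i i = - X 1 1.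
  split=> [i j nij|i].
    have [] := H i j; rewrite (negPf nij) !mul0r !add0r => e1 e2.
    have xij : x i - x j != 0 by rewrite subr_eq0 (inj_eq xinj).
    have Yij : Y i j = 0.
      apply: (mulf_eq0r xij).
      transitivity (x i * (Y i j + Z j i) - (Y i j * x j + x i * Z j i)).
        by ring.
      by rewrite e1 e2 mulr0 subr0.
    by split=> //; rewrite -[RHS]e2 Yij add0r.
  have := H i i; rewrite eqxx !mul1r X00 X10.
  have := Y0 i; rewrite !mxE => -> [e1 e2].
  have Zii : Z i i = - X 1 1 by rewrite -[RHS]add0r -[X in X + _]e2; ring.
  split=> //; apply/eqP; rewrite -subr_eq0 -[X in _ == X]e1 Zii; apply/eqP; ring.
have X11 : X 1 1 = 0.
  apply: (mulf_eq0r x12); have [e1 _] := Xdiag i1; have [e2 _] := Xdiag i2.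
  by rewrite mulrC mulrBr -e1 -e2 subrr.
have X01 : X 0 1 = 0 by have [-> _] := Xdiag i1; rewrite X11 mul0r.
have -> : X = 0.
  by apply/matrixP => i j; rewrite mxE; elim/ord2_ind: i; elim/ord2_ind: j.
have -> : Y = 0.
  apply/matrixP => i j; rewrite mxE; have [<-|/Zoff[]//] := eqVneq i j.
  by have := Y0 i; rewrite !mxE.
have -> : Z = 0.
  apply/matrixP => i j; rewrite mxE; have [<-|] := eqVneq i j.
    by have [_ ->] := Xdiag i; rewrite X11 oppr0.
  by rewrite eq_sym => /Zoff[].
by rewrite /gl_row !linear0 !row_mx0.
Qed.

(** The diagonal matrix units, and also [delta_mx i j] because [x i = x j], commute with the
    diagonal matrix; with Z = - Y each gives a stabilizer element, n + 1 in all besides the scalar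
    pair. *)
Lemma rank_pencil_noninj (i j : 'I_n) : i != j -> x i = x j ->
  (\rank (tangent_mx (pencil_state x)) + n.+2 <= N)%N.
Proof.
move=> nij xij; rewrite -[n.+2]/(n.+1.+1) -[n.+1]addn1.
pose Ys : 'M[F]_(n + 1, n * n) :=
  col_mx (\matrix_k mxvec (delta_mx k k)) (mxvec (delta_mx i j)).
apply: (@rank_tangent_le _ _ _ Ys).
  apply: inj_row_free => u; rewrite -[u]hsubmxK mul_row_col.
  set a := lsubmx u; set b := rsubmx u; rewrite [b]mx11_scalar mul_scalar_mx.
  rewrite mulmx_sum_row (eq_bigr (fun k => mxvec (a 0 k *: delta_mx k k))).
    rewrite -linear_sum -linearZ -linearD /= -(linear0 (@mxvec F n n)).
    move=> /(can_inj mxvecK)/matrixP H.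
    have -> : a = 0.
      apply/rowP => k; have := H k k; rewrite !mxE summxE (bigD1 k) //= big1.
        rewrite !mxE !eqxx mulr1 addr0.
        rewrite (_ : (k == i) && (k == j) = false) ?mulr0 ?addr0 //.
        by apply/negbTE/negP => /andP[/eqP E1 /eqP E2]; move: nij; rewrite -E1 -E2 eqxx.
      by move=> l nl; rewrite !mxE eq_sym (negPf nl) mulr0.
    have := H i j; rewrite !mxE summxE big1 ?add0r ?eqxx ?mulr1 => [->|k _].
      by rewrite raddf0 row_mx0.
    rewrite !mxE (_ : (i == k) && (j == k) = false) ?mulr0 //.
    by apply/negbTE/negP => /andP[/eqP E1 /eqP E2]; move: nij; rewrite E1 E2 eqxx.
  by move=> k _; rewrite rowK linearZ.
have comm Y : Y *m diag_mx (\row_k x k) = diag_mx (\row_k x k) *m Y ->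
    exists Z, Y *m diag_mx (\row_k x k) + diag_mx (\row_k x k) *m Z = 0 /\
              Y *m 1%:M + 1%:M *m Z = 0.
  move=> cY; exists (- Y); rewrite /= !mulmxN mulmx1 mul1mx subrr; split=> //.
  by rewrite cY subrr.
have commE k l : x k = x l ->
    (delta_mx k l : 'M[F]_n) *m diag_mx (\row_k x k) = diag_mx (\row_k x k) *m delta_mx k l.
  move=> xkl; rewrite mul_mx_diag mul_diag_mx; apply/matrixP => p q; rewrite !mxE.
  by have [->|] := eqVneq p k; have [->|] := eqVneq q l; rewrite ?mulr0 ?mul0r //= xkl mulrC.
move=> k; rewrite /Ys; have [l ->|l ->] := split_ordP k.
  by rewrite rowKu rowK mxvecK; apply/comm/commE.
by rewrite rowKd (_ : row l _ = mxvec (delta_mx i j)) ?mxvecK;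
  [apply/comm/commE | apply/rowP => m; rewrite mxE [l]ord1].
Qed.

End PencilOrbit.

End OrbitDimension.

(** * A lower bound for the dimension of every stabilizer *)

Section GenericBound.
Variable F : numFieldType.

Definition polyfun (f : F -> F) := exists p : {poly F}, forall t, f t = p.[t].

Lemma polyfun_subring : fun_subring polyfun.
Proof.
split=> [c|f g [p fp] [q gq]|f g [p fp] [q gq]].
- by exists c%:P => t; rewrite hornerC.
- by exists (p + q) => t; rewrite hornerD fp gq.
- by exists (p * q) => t; rewrite hornerM fp gq.
Qed.

(** In characteristic zero the integers below [size p] are already too many roots for a nonzero
    [p]. *)
Lemma poly_nonroot (p : {poly F}) : p != 0 -> exists t, p.[t] != 0.
Proof.
move=> p0; apply: contrapT => allroot.
have := @max_poly_roots _ p [seq i%:R | i <- iota 0 (size p)] p0.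
rewrite size_map size_iota ltnn.
suff -> : all (root p) [seq i%:R | i <- iota 0 (size p)].
  rewrite map_inj_uniq ?iota_uniq; first by move/(_ isT isT).
  by move=> i j /eqP; rewrite eqr_nat => /eqP.
apply/allP => _ /mapP[i _ ->]; rewrite rootE; apply: contrapT => /negP nr.
by apply: allroot; exists i%:R.
Qed.

Lemma polyfun_nonroot (f g : F -> F) : polyfun f -> polyfun g ->
  (exists t, f t != 0) -> (exists t, g t != 0) -> exists t, f t * g t != 0.
Proof.
move=> [p fp] [q gq] [t ft] [u gu].
have p0 : p != 0 by apply: contraNneq ft => p0; rewrite fp p0 horner0.
have q0 : q != 0 by apply: contraNneq gu => q0; rewrite gq q0 horner0.
have [v] := poly_nonroot (mulf_neq0 p0 q0).
by rewrite hornerM -fp -gq; exists v.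
Qed.

(** Turns a lower bound on the rank into a nonvanishing determinant [\det (E *m M *m G)], a
    polynomial condition that survives perturbation of [M]. *)
Lemma mxrank_ge_id m n r (M : 'M[F]_(m, n)) : (r <= \rank M)%N ->
  exists E G, E *m M *m G = 1%:M :> 'M_r.
Proof.
move=> rM; exists (pid_mx r *m invmx (col_ebase M)), (invmx (row_ebase M) *m pid_mx r).
rewrite -{2}(mulmx_ebase M) !mulmxA mulmxKV ?col_ebase_unit //.
rewrite mulmxK ?row_ebase_unit // !mul_pid_mx.
have rm := leq_trans rM (rank_leq_row M); have rn := leq_trans rM (rank_leq_col M).
rewrite -[RHS]pid_mx_1; congr pid_mx; lia.
Qed.

Variable n : nat.
Local Notation N := (2 * 2 + (n.+1 * n.+1 + n.+1 * n.+1))%N.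

(* If Q is invertible, every power of W = P adj(Q) gives an element of the
   stabilizer; generically these powers are independent. *)
Lemma rank_tangent_nonderogatory (s : 'M[F]_n.+1 * 'M[F]_n.+1) :
    s.2 \in unitmx ->
    \det (\matrix_(i < n.+1, j < n.+1) ((s.1 *m \adj s.2) ^+ i) j j) != 0 ->
  (\rank (tangent_mx s) + n.+2 <= N)%N.
Proof.
case: s => P Q /=; set W := P *m \adj Q => Qu detW.
apply: (@rank_tangent_le _ _ _ _ (\matrix_(i < n.+1) mxvec (W ^+ i))).
  apply: inj_row_free => u uY0.
  (* On the diagonal, a relation between the powers of [W] becomes a relation between the rows of
     the matrix in [detW], which is invertible. *)
  have : u *m \matrix_(i < n.+1, j < n.+1) (W ^+ i) j j = 0.
    move: uY0; rewrite mulmx_sum_row (eq_bigr (fun i => mxvec (u 0 i *: W ^+ i))).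
      rewrite -linear_sum -(linear0 (@mxvec F n.+1 n.+1)).
      move=> /(can_inj mxvecK)/matrixP H; apply/rowP => j.
      have := H j j; rewrite summxE !mxE => {2}<-.
      by apply: eq_bigr => i _; rewrite !mxE.
    by move=> i _; rewrite rowK linearZ.
  move/(canRL (mulmxK _)); rewrite unitmxE unitfE detW => -> //.
  by rewrite mul0mx.
move=> k; rewrite rowK mxvecK /=; exists (- (invmx Q *m W ^+ k *m Q)).
rewrite !mulmxN !mulmxA mulmxV // mul1mx subrr; split=> //.
have PQ : P *m invmx Q = (\det Q)^-1 *: W.
  by rewrite /invmx Qu -scalemxAr.
have WQ : W *m Q = \det Q *: P by rewrite /W -mulmxA mul_adj_mx mul_mx_scalar.
have cW : W *m W ^+ k = W ^+ k *m W by rewrite -[LHS]exprS exprSr.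
rewrite PQ -!scalemxAl cW -mulmxA WQ -scalemxAr scalerA mulVf ?scale1r ?subrr //.
by rewrite -unitfE -unitmxE.
Qed.

(** Rank is lower semicontinuous: too large a rank at [s] would persist at generic points of the
    line from [s0] to [s]. But [s0] has distinct eigenvalues, its powers have Vandermonde diagonals,
    and so generic points of the line satisfy [rank_tangent_nonderogatory]. *)
Lemma rank_tangent_bound (s : 'M[F]_n.+1 * 'M[F]_n.+1) :
  (\rank (tangent_mx s) + n.+2 <= N)%N.
Proof.
rewrite leqNgt; apply/negP => bad.
(* [k] is the smallest rank that violates the bound. *)
pose k := (N - n.+1)%N; have [|E [G EG]] := @mxrank_ge_id _ _ k (tangent_mx s).
  by rewrite /k; lia.
pose s0 := (diag_mx (\row_(i < n.+1) (i%:R : F)), 1%:M : 'M[F]_n.+1).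
pose st t : 'M[F]_n.+1 * 'M[F]_n.+1 :=
  (t *: s.1 + (1 - t) *: s0.1, t *: s.2 + (1 - t) *: s0.2).
have S := polyfun_subring.
have Sid : polyfun id by exists 'X => t; rewrite hornerX.
have SidC : polyfun (fun t => 1 - t).
  exact: (subringD S (subring_cst S 1) (subringN S Sid)).
have Slin m p (A B : 'M[F]_(m, p)) :
    mx_in polyfun (fun t => t *: A + (1 - t) *: B).
  by apply: (mx_inD S); apply: (mx_inZ S) => //; apply: (mx_in_cst S).
pose f t := \det (E *m tangent_mx (st t) *m G).
pose g t := \det (st t).2.
(* The adjugate, unlike the inverse, is polynomial in [t]. *)
pose W t := (st t).1 *m \adj (st t).2.
pose h t := \det (\matrix_(i < n.+1, j < n.+1) (W t ^+ i) j j).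
have Sf : polyfun f.
  apply: (subring_det S); apply: (mx_inM S); last exact: (mx_in_cst S).
  apply: (mx_inM S); first exact: (mx_in_cst S).
  rewrite (_ : (fun t => _) = fun t => t *: tangent_mx s + (1 - t) *: tangent_mx s0) //.
  by apply: funext => t; rewrite tangent_mx_linear.
have Sg : polyfun g by apply: (subring_det S); apply: Slin.
have Sh : polyfun h.
  apply: (subring_det S) => i j.
  have SW : mx_in polyfun W.
    by apply: (mx_inM S); [|apply: (mx_in_adj S)]; apply: Slin.
  have := mx_inX S i SW j j; congr polyfun; apply: funext => t.
  by rewrite mxE.
have f1 : exists t, f t != 0.
  exists 1; rewrite /f /st subrr !scale0r !scale1r !addr0.
  by rewrite -surjective_pairing EG det1 oner_eq0.
have st0 : st 0 = s0 by rewrite /st subr0 !scale0r !scale1r !add0r.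
have g0 : exists t, g t != 0 by exists 0; rewrite /g st0 det1 oner_eq0.
have h0 : exists t, h t != 0.
  exists 0; rewrite /h /W st0 /= adj1 mulmx1.
  rewrite (_ : \matrix_(i, j) _ = Vandermonde n.+1 (\row_(k < n.+1) k%:R)).
    rewrite det_Vandermonde; apply/prodf_neq0 => i _; apply/prodf_neq0 => j ij.
    by rewrite !mxE subr_eq0 eqr_nat neq_ltn ij orbT.
  apply/matrixP => i j; rewrite mxE [RHS]mxE.
  elim: (i : nat) j => [|m IH] j; first by rewrite !expr0 mxE eqxx.
  by rewrite !exprSr -[_ * diag_mx _]/(_ *m diag_mx _) mul_mx_diag mxE IH.
have [|t] := polyfun_nonroot Sf (subringM S Sg Sh) f1.
  exact: polyfun_nonroot.
rewrite !mulf_eq0 !negb_or => /and3P[ft gt ht].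
have := @rank_tangent_nonderogatory (st t).
rewrite unitmxE unitfE => /(_ gt ht).
have : (k <= \rank (tangent_mx (st t)))%N.
  have fu : E *m tangent_mx (st t) *m G \in unitmx by rewrite unitmxE unitfE.
  rewrite -{1}(mxrank_unit fu).
  exact: leq_trans (mxrankM_maxl _ _) (mxrankM_maxr _ _).
rewrite /k; lia.
Qed.

End GenericBound.

(** * Norm estimates for the root vectors *)

Section Norms.
Variable R : realType.
Local Notation C := (R[i])%C.
Implicit Types z w : C.

(** The modulus as an element of [R], whose order is total; the norm of [z] in the library sense
    lies in [C]. *)
Definition cnorm z : R := ComplexField.Normc.normc z.

Lemma normr_cnorm z : `|z| = (cnorm z)%:C%C. Proof. by []. Qed.
Lemma cnorm_ge0 z : 0 <= cnorm z.
Proof. by case: z => a b; apply: sqrtr_ge0. Qed.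
Lemma cnormM z w : cnorm (z * w) = cnorm z * cnorm w.
Proof. exact: ComplexField.Normc.normcM. Qed.
Lemma cnormD z w : cnorm (z + w) <= cnorm z + cnorm w.
Proof. exact: le_normcD. Qed.
Lemma cnormN z : cnorm (- z) = cnorm z.
Proof. exact: normcN. Qed.
Lemma cnormB z w : cnorm (z - w) <= cnorm z + cnorm w.
Proof. by rewrite -(cnormN w) cnormD. Qed.
Lemma cnorm0 : cnorm 0 = 0. Proof. exact: ComplexField.Normc.normc0. Qed.
Lemma cnorm1 : cnorm 1 = 1. Proof. exact: ComplexField.Normc.normc1. Qed.
Lemma cnorm_eq0 z : (cnorm z == 0) = (z == 0).
Proof.
by apply/eqP/eqP => [/ComplexField.Normc.eq0_normc|->]; rewrite ?cnorm0.
Qed.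
Lemma cnorm_gt0 z : (0 < cnorm z) = (z != 0).
Proof. by rewrite lt_def cnorm_eq0 cnorm_ge0 andbT. Qed.
Lemma cnormR (r : R) : 0 <= r -> cnorm r%:C%C = r.
Proof. by move=> r0; rewrite /cnorm /= expr0n addr0 sqrtr_sqr ger0_norm. Qed.
Lemma cnorm_nat k : cnorm k%:R = k%:R.
Proof.
rewrite -(rmorph_nat (real_complex R)); apply: cnormR; exact: ler0n.
Qed.
Lemma cnorm_prod I (r : seq I) (P : pred I) (f : I -> C) :
  cnorm (\prod_(i <- r | P i) f i) = \prod_(i <- r | P i) cnorm (f i).
Proof. exact: (big_morph _ cnormM cnorm1). Qed.
Lemma cnorm_sum I (r : seq I) (P : pred I) (f : I -> C) :
  cnorm (\sum_(i <- r | P i) f i) <= \sum_(i <- r | P i) cnorm (f i).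
Proof.
elim/big_rec2: _ => [|i y z _ H]; first by rewrite cnorm0.
by apply: (le_trans (cnormD _ _)); rewrite lerD2l.
Qed.

Lemma cnorm_det n (M : 'M[C]_n) (d : R) :
  (forall i j, cnorm (M i j) <= d) -> cnorm (\det M) <= n`!%:R * d ^+ n.
Proof.
move=> Md; apply: (le_trans (cnorm_sum _ _ _)).
rewrite -card_Sn -sum1_card natr_sum mulr_suml; apply: ler_sum => s _.
rewrite mul1r cnormM cnorm_prod.
have -> : cnorm ((-1) ^+ s) = 1.
  by case: (s : bool); rewrite ?expr1 ?expr0 ?cnormN cnorm1.
rewrite mul1r -[X in _ ^+ X]card_ord -prodr_const; apply: ler_prod => i _.
by rewrite cnorm_ge0 Md.
Qed.

Lemma mxBE (V : zmodType) m n (M M' : 'M[V]_(m, n)) i j :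
  (M - M') i j = M i j - M' i j.
Proof. by rewrite !mxE. Qed.

Lemma mxDZE (K : pzRingType) m n (z : K) (M M' : 'M[K]_(m, n)) i j :
  (M + z *: M') i j = M i j + z * M' i j.
Proof. by rewrite !mxE. Qed.

Lemma in_orbit_closureP n (s phi : state R n) : in_orbit_closure s phi <->
  forall d : R, 0 < d -> exists A B D, inG A B D /\
    forall i j, cnorm ((act A B D s).1 i j - phi.1 i j) <= d /\
                cnorm ((act A B D s).2 i j - phi.2 i j) <= d.
Proof.
split=> [H d d0|H e e0].
  have [|A [B [D [g lt_d]]]] := H (d ^+ 2)%:C%C; first by rewrite ltcR exprn_gt0.
  exists A, B, D; split=> // i j; move: lt_d; rewrite /sqnorm.
  set P := (sub_state _ _).1; set Q := (sub_state _ _).2.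
  rewrite -!mxBE -/P -/Q.
  under eq_bigr do under eq_bigr do rewrite !normr_cnorm -!rmorphXn -rmorphD.
  under eq_bigr do rewrite -rmorph_sum; rewrite -rmorph_sum ltcR /= => lt_d.
  have : cnorm (P i j) ^+ 2 + cnorm (Q i j) ^+ 2 < d ^+ 2.
    apply: le_lt_trans lt_d; rewrite (bigD1 i) //= (bigD1 j) //= -addrA lerDl.
    by rewrite addr_ge0 ?sumr_ge0 // => *; rewrite ?sumr_ge0 // => *;
      rewrite addr_ge0 ?sqr_ge0.
  have dge0 := ltW d0; move=> /ltW le2.
  by split; rewrite -(@ler_pXn2r _ 2) ?nnegrE ?cnorm_ge0 //;
    apply: le_trans le2; rewrite ?lerDl ?lerDr sqr_ge0.
have : 0 < complex.Re e by move: e0; rewrite ltcE => /andP[].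
have eE : e = (complex.Re e)%:C%C by rewrite RRe_real // gtr0_real.
set r := complex.Re e => r0; rewrite eE -/r.
(* As d <= 1, each of the 2 n^2 squares is at most [d]; the extra 1 in the denominator makes the
   final inequality strict. *)
pose d := Num.min 1 (r / (n * n).*2.+1%:R).
have d0 : 0 < d by rewrite lt_min ltr01 divr_gt0.
have [A [B [D [g le_d]]]] := H d d0.
exists A, B, D; split=> //; rewrite /sqnorm.
under eq_bigr do under eq_bigr do rewrite !normr_cnorm -!rmorphXn -rmorphD.
under eq_bigr do rewrite -rmorph_sum; rewrite -rmorph_sum ltcR /=.
apply: (@le_lt_trans _ _ (\sum_(i < n) \sum_(j < n) (d + d))).
  apply: ler_sum => i _; apply: ler_sum => j _.
  have d1 : d <= 1 by rewrite ge_min lexx.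
  have sq z : cnorm z <= d -> cnorm z ^+ 2 <= d.
    move=> zd; rewrite expr2 -[leRHS]mulr1 ler_pM ?cnorm_ge0 //.
    exact: le_trans d1.
  by have [] := le_d i j; rewrite -!mxBE => l1 l2; rewrite lerD // sq.
rewrite !sumr_const !card_ord -mulrnA -mulr2n -mulrnA.
have : d * (n * n).*2.+1%:R <= r by rewrite -ler_pdivlMr // ge_min lexx orbT.
by apply: lt_le_trans; rewrite -[X in X < _]mulr_natr ltr_pM2l // ltr_nat; lia.
Qed.

End Norms.

(** * Linear factors of the determinant form *)

Section PencilForm.
Variables (R : realType) (n : nat).
Local Notation C := (R[i])%C.
Implicit Types (x : 'I_n -> C) (A : 'M[C]_2).

Definition root_vec1 A x k : C := A 0 0 * x k + A 0 1.
Definition root_vec2 A x k : C := A 1 0 * x k + A 1 1.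
Definition root_norm A x k : R := cnorm (root_vec1 A x k) + cnorm (root_vec2 A x k).
Definition norm2 A : R :=
  cnorm (A 0 0) + cnorm (A 0 1) + (cnorm (A 1 0) + cnorm (A 1 1)).

Lemma mulmx_comb (K : comPzRingType) m (a b : K) (B P Q D : 'M[K]_m) :
  a *: (B *m P *m D) + b *: (B *m Q *m D) = B *m (a *: P + b *: Q) *m D.
Proof. by rewrite mulmxDr mulmxDl -!scalemxAr -!scalemxAl. Qed.

Lemma act_pencil A B D x : act A B D (pencil_state x) =
  (B *m diag_mx (\row_k root_vec1 A x k) *m D^T,
   B *m diag_mx (\row_k root_vec2 A x k) *m D^T).
Proof.
congr pair; apply: etrans (mulmx_comb _ _ _ _ _ _) _; congr (_ *m _ *m _);
  apply/matrixP => i j; rewrite !mxE;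
  by case: (i == j); rewrite ?mulr1n ?mulr0n ?mulr1 ?mulr0 ?addr0.
Qed.

Lemma det_act_pencil A B D x z : inG A B D ->
  \det ((act A B D (pencil_state x)).1 + z *: (act A B D (pencil_state x)).2) =
  \prod_k (root_vec1 A x k + z * root_vec2 A x k).
Proof.
move=> [_ [detB detD]]; rewrite act_pencil -[X in X + _]scale1r mulmx_comb.
rewrite !det_mulmx det_tr detB detD mul1r mulr1.
rewrite (_ : _ + _ = diag_mx (\row_k (root_vec1 A x k + z * root_vec2 A x k))).
  by rewrite det_diag; apply: eq_bigr => k _; rewrite mxE.
apply/matrixP => i j; rewrite !mxE.
by case: (i == j); rewrite ?mulr1n ?mulr0n ?mulr0 ?addr0 ?mul1r.
Qed.

Lemma root_norm_ge0 A x k : 0 <= root_norm A x k.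
Proof. by rewrite addr_ge0 ?cnorm_ge0. Qed.

Lemma norm2_ge0 A : 0 <= norm2 A.
Proof. by rewrite !addr_ge0 ?cnorm_ge0. Qed.

Lemma mx22_det A : \det A = A 0 0 * A 1 1 - A 0 1 * A 1 0.
Proof.
rewrite (expand_det_row _ 0) !big_ord_recl big_ord0 addr0 /cofactor !det_mx11.
rewrite !mxE /= expr0 expr1 mul1r mulN1r mulrN.
by congr (_ * A _ _ - A _ _ * A _ _); apply: val_inj.
Qed.

Lemma norm2_ge1 A : \det A = 1 -> 1 <= norm2 A.
Proof.
rewrite mx22_det => detA; have := norm2_ge0 A; rewrite /norm2.
have := cnormB (A 0 0 * A 1 1) (A 0 1 * A 1 0); rewrite detA cnorm1 !cnormM.
have := cnorm_ge0 (A 0 0); have := cnorm_ge0 (A 0 1).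
have := cnorm_ge0 (A 1 0); have := cnorm_ge0 (A 1 1).
move: (cnorm _) (cnorm _) (cnorm _) (cnorm _) => d c b a; nra.
Qed.

Lemma root_norm_le A x k : root_norm A x k <= (1 + cnorm (x k)) * norm2 A.
Proof.
rewrite /root_norm /root_vec1 /root_vec2 /norm2.
have := cnormD (A 0 0 * x k) (A 0 1); have := cnormD (A 1 0 * x k) (A 1 1).
rewrite !cnormM.
have := cnorm_ge0 (A 0 0); have := cnorm_ge0 (A 0 1).
have := cnorm_ge0 (A 1 0); have := cnorm_ge0 (A 1 1); have := cnorm_ge0 (x k).
nra.
Qed.

(** Cramer's rule: [A] is recovered from its values on (x_k, 1) and (x_j, 1), whose determinant is
    x_k - x_j. *)
Lemma norm2_le A x k j :
  cnorm (x k - x j) * norm2 A <=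
  (1 + cnorm (x k) + cnorm (x j)) * (root_norm A x k + root_norm A x j).
Proof.
have e1 : (x k - x j) * A 0 0 = root_vec1 A x k - root_vec1 A x j.
  by rewrite /root_vec1; ring.
have e2 : (x k - x j) * A 0 1 = x k * root_vec1 A x j - x j * root_vec1 A x k.
  by rewrite /root_vec1; ring.
have e3 : (x k - x j) * A 1 0 = root_vec2 A x k - root_vec2 A x j.
  by rewrite /root_vec2; ring.
have e4 : (x k - x j) * A 1 1 = x k * root_vec2 A x j - x j * root_vec2 A x k.
  by rewrite /root_vec2; ring.
rewrite /norm2 !mulrDr -!cnormM e1 e2 e3 e4 /root_norm.
move: (root_vec1 A x k) (root_vec2 A x k) (root_vec1 A x j) (root_vec2 A x j).
move=> k1 k2 j1 j2 {e1 e2 e3 e4}.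
have := cnormB k1 j1; have := cnormB k2 j2.
have := cnormB (x k * j1) (x j * k1); have := cnormB (x k * j2) (x j * k2).
rewrite !cnormM.
have := cnorm_ge0 k1; have := cnorm_ge0 k2; have := cnorm_ge0 j1; have := cnorm_ge0 j2.
have := cnorm_ge0 (x k); have := cnorm_ge0 (x j); nra.
Qed.

(** The determinant of the two root vectors equals [\det A] times x_k - x_j. *)
Lemma root_norm_det A x k j : \det A = 1 ->
  cnorm (x k - x j) <= root_norm A x k * root_norm A x j.
Proof.
rewrite mx22_det => detA.
have -> : x k - x j =
    root_vec1 A x k * root_vec2 A x j - root_vec2 A x k * root_vec1 A x j.
  rewrite -[LHS]mulr1 -detA /root_vec1 /root_vec2; ring.
rewrite /root_norm.
move: (root_vec1 A x k) (root_vec2 A x k) (root_vec1 A x j) (root_vec2 A x j).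
move=> k1 k2 j1 j2; have := cnormB (k1 * j2) (k2 * j1); rewrite !cnormM.
have := cnorm_ge0 k1; have := cnorm_ge0 k2; have := cnorm_ge0 j1; have := cnorm_ge0 j2.
nra.
Qed.

(* Each linear form is small at no more than one of the n + 1 points (1, i), so
   some point is good for all n factors. *)
Lemma prod_root_norm_le (w1 w2 : 'I_n -> C) : exists i : 'I_n.+1,
  (n.*2.+4%:R^-1) ^+ n * \prod_k (cnorm (w1 k) + cnorm (w2 k)) <=
  cnorm (\prod_k (w1 k + i%:R * w2 k)).
Proof.
(* With q = |w| / (2n + 4), two bad points for the same form would give |w2| <= 2q and |w1| <= q + n
   |w2|, hence |w| <= (2n + 3) q, which is less than |w|. *)
pose bad k := [set i : 'I_n.+1 |
  cnorm (w1 k + i%:R * w2 k) < n.*2.+4%:R^-1 * (cnorm (w1 k) + cnorm (w2 k))].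
have bad1 k : (#|bad k| <= 1)%N.
  apply/card_le1_eqP => i j; rewrite !inE => bi bj.
  apply/eqP; apply: contraT => nij.
  set N := cnorm (w1 k) + cnorm (w2 k) in bi bj.
  have N0 : 0 <= N by rewrite addr_ge0 ?cnorm_ge0.
  set q := n.*2.+4%:R^-1 * N in bi bj.
  have lt2 : cnorm (w2 k) <= 2 * q.
    have : cnorm ((i%:R - j%:R) * w2 k) <= 2 * q.
      have -> : (i%:R - j%:R) * w2 k = (w1 k + i%:R * w2 k) - (w1 k + j%:R * w2 k).
        by ring.
      by apply: (le_trans (cnormB _ _)); lra.
    apply: le_trans; rewrite cnormM ler_peMl ?cnorm_ge0 //.
    have [lij|lij|/val_inj E] := ltngtP i j; last by rewrite E eqxx in nij.
      by rewrite -cnormN opprB -natrB ?(ltnW lij) // cnorm_nat ler1n subn_gt0.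
    by rewrite -natrB ?(ltnW lij) // cnorm_nat ler1n subn_gt0.
  have lt1 : cnorm (w1 k) <= q + n%:R * cnorm (w2 k).
    have -> : w1 k = (w1 k + i%:R * w2 k) - i%:R * w2 k by ring.
    apply: (le_trans (cnormB _ _)); rewrite cnormM cnorm_nat.
    apply: lerD; first exact: ltW.
    by rewrite ler_wpM2r ?cnorm_ge0 // ler_nat -ltnS.
  have inv0 : n.*2.+4%:R * n.*2.+4%:R^-1 = 1 :> R by rewrite divff ?pnatr_eq0.
  have n4 : n.*2.+4%:R = 2 * n%:R + 4 :> R.
    by rewrite -muln2 -addn4 natrD natrM mulrC.
  have n0 : 0 <= n%:R :> R := ler0n _ _.
  have Nlt : N < 0 \/ N = 0 \/ 0 < N by case: (ltgtP N 0); auto.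
  have i0 : 0 < n.*2.+4%:R^-1 :> R by rewrite invr_gt0 ltr0n.
  have le3 : N <= (2 * n%:R + 3) * q.
    rewrite {1}/N; nra.
  have : (2 * n%:R + 4) * q = N.
    by rewrite -n4 /q mulrA inv0 mul1r.
  have := cnorm_ge0 (w1 k + i%:R * w2 k).
  move: le3 bi; nra.
have : (#|\bigcup_k bad k| < n.+1)%N.
  rewrite ltnS; apply: (@leq_trans (\sum_(k < n) 1)); last first.
    by rewrite sum1_card card_ord.
  apply: (@leq_trans (\sum_(k < n) #|bad k|)); last by apply: leq_sum => k _; apply: bad1.
  elim/big_rec2: _ => [|k m B _ H]; first by rewrite cards0.
  by apply: (leq_trans (leq_card_setU _ _)); rewrite leq_add2l.
rewrite -[X in (_ < X)%N]card_ord -cardsT => lt_card.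
have [i0 ni] : exists i, i \notin \bigcup_k bad k.
  apply/existsP; rewrite -negb_forall; apply/negP => /forallP all_bad.
  move: lt_card; rewrite ltnNge subset_leq_card //.
  by apply/fintype.subsetP => i _; apply: all_bad.
exists i0; rewrite cnorm_prod -[X in _ ^+ X]card_ord -prodr_const -big_split /=.
apply: ler_prod => k _; rewrite mulr_ge0 ?addr_ge0 ?cnorm_ge0 ?invr_ge0 ?ler0n //=.
rewrite leNgt; apply: contra ni => bk; apply/bigcupP; exists k => //.
by rewrite inE.
Qed.

(** At the good point z = i <= n the product of the factors is a determinant whose entries are at
    most e + n e. *)
Lemma prod_root_norm_act A B D x (e : R) : inG A B D ->
    (forall i j, cnorm ((act A B D (pencil_state x)).1 i j) <= e /\
                 cnorm ((act A B D (pencil_state x)).2 i j) <= e) ->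
  (n.*2.+4%:R^-1) ^+ n * \prod_k root_norm A x k <= n`!%:R * (n.+1%:R * e) ^+ n.
Proof.
move=> g bnd.
have [j0] := prod_root_norm_le (root_vec1 A x) (root_vec2 A x).
move/le_trans; apply; rewrite -(det_act_pencil _ _ g); apply: cnorm_det => k j.
have [b1 b2] := bnd k j; rewrite mxDZE; apply: (le_trans (cnormD _ _)).
have -> : n.+1%:R * e = e + n%:R * e by rewrite -add1n natrD mulrDl mul1r.
rewrite lerD // cnormM cnorm_nat.
by rewrite ler_pM ?cnorm_ge0 ?ler0n // ler_nat -ltnS.
Qed.

Definition multiplicity x k := #|[set j | x j == x k]|.

Lemma card_multiplicity x k : #|[pred j | x j == x k]| = multiplicity x k.
Proof. by rewrite /multiplicity cardsE. Qed.

Lemma card_neq_multiplicity x k :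
  #|[pred j | x j != x k]| = (n - multiplicity x k)%N.
Proof.
have : (multiplicity x k + #|[pred j | x j != x k]| = n)%N.
  apply: etrans (card_ord n); rewrite -card_multiplicity.
  exact: (cardC [pred j | x j == x k]).
lia.
Qed.

Lemma root_norm_gt0 A x k j : \det A = 1 -> x k != x j -> 0 < root_norm A x k.
Proof.
move=> detA nkj; rewrite lt_def root_norm_ge0 andbT; apply/eqP => r0.
have := root_norm_det x k j detA; rewrite r0 mul0r leNgt.
by rewrite cnorm_gt0 subr_eq0 nkj.
Qed.

(** By [norm2_le], root vectors of two different eigenvalues cannot both be small compared with [A].
    By [root_norm_det], a small one is still at least of order 1/|A|, since its partner is at most
    of order |A|. *)
Lemma root_norm_dichotomy x : (exists k j, x k != x j) -> exists c : R, 0 < c /\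
  forall A, \det A = 1 -> exists k,
    (forall j, x j != x k -> c * norm2 A <= root_norm A x j) /\
    (forall j, c / norm2 A <= root_norm A x j).
Proof.
move=> [k1 [k2 nk12]].
(* The constant of [norm2_le] for one pair; [c0] dominates all of them. When k = j the quotient is 0
   by convention and does no harm. *)
pose q k j := (1 + cnorm (x k) + cnorm (x j)) / cnorm (x k - x j).
pose c0 := 1 + \sum_k \sum_j q k j.
have q_ge0 k j : 0 <= q k j by rewrite divr_ge0 ?addr_ge0 ?cnorm_ge0.
have qc0 k j : q k j <= c0.
  have l1 : q k j <= \sum_l q k l by rewrite (bigD1 j) //= lerDl sumr_ge0.
  have l2 : \sum_l q k l <= \sum_i \sum_l q i l.
    by rewrite [leRHS](bigD1 k) //= lerDl sumr_ge0 // => l _; rewrite sumr_ge0.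
  by apply: (le_trans l1); apply: (le_trans l2); rewrite /c0 lerDr.
have c0_gt0 : 0 < c0.
  by rewrite ltr_pwDl // sumr_ge0 // => k _; rewrite sumr_ge0.
have bnd k j : x k != x j ->
    1 + cnorm (x k) + cnorm (x j) <= c0 * cnorm (x k - x j).
  by rewrite -subr_eq0 -cnorm_gt0 => n0; rewrite -ler_pdivrMr //; apply: qc0.
(* The factor 2 makes two root norms below the threshold add up to less than |A| / c0. *)
exists (2 * c0)^-1; split=> [|A detA]; first by rewrite invr_gt0 mulr_gt0.
have A1 := norm2_ge1 detA; have A0 : 0 < norm2 A by apply: lt_le_trans A1.
have sum_ge k j : x k != x j -> norm2 A <= c0 * (root_norm A x k + root_norm A x j).
  move=> nkj; have n0 : 0 < cnorm (x k - x j) by rewrite cnorm_gt0 subr_eq0.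
  rewrite -(ler_pM2l n0); apply: (le_trans (norm2_le A x k j)).
  rewrite mulrA [_ * c0]mulrC ler_wpM2r ?bnd //.
  by rewrite addr_ge0 ?root_norm_ge0.
have inv_ge j : (2 * c0)^-1 / norm2 A <= root_norm A x j.
  have [k nk] : exists k, x j != x k.
    have [E|] := eqVneq (x j) (x k1); last by exists k1.
    by exists k2; rewrite E.
  have n0 : 0 < cnorm (x j - x k) by rewrite cnorm_gt0 subr_eq0.
  have rj := root_norm_gt0 detA nk.
  rewrite -invfM invf_ple ?posrE ?mulr_gt0 // -div1r ler_pdivrMr //.
  have l1 := root_norm_det x j k detA; have l2 := root_norm_le A x k.
  have l3 := bnd _ _ nk; have r0 := root_norm_ge0 A x j.
  have l4 : cnorm (x j - x k) <= c0 * cnorm (x j - x k) * norm2 A * root_norm A x j.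
    apply: (le_trans l1); rewrite mulrC ler_wpM2r //; apply: (le_trans l2).
    rewrite ler_wpM2r ?(ltW A0) //; apply: le_trans l3.
    by rewrite -addrA lerD2l lerDr cnorm_ge0.
  have l5 : 1 <= c0 * norm2 A * root_norm A x j.
    rewrite -(ler_pM2l n0) mulr1; apply: (le_trans l4).
    by rewrite [leLHS](_ : _ = cnorm (x j - x k) * (c0 * norm2 A * root_norm A x j)) //; ring.
  apply: (le_trans l5); rewrite -!mulrA -[leLHS]mul1r ler_wpM2r ?ler1n //.
  by rewrite !mulr_ge0 // ltW.
have [[k kbad]|nobad] := pselect (exists k, root_norm A x k < (2 * c0)^-1 * norm2 A).
  exists k; split=> // j njk; rewrite leNgt; apply/negP => jbad.
  have := sum_ge _ _ njk; have : root_norm A x j + root_norm A x k < c0^-1 * norm2 A.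
    apply: (lt_le_trans (ltrD jbad kbad)).
    have -> : (2 * c0)^-1 = c0^-1 / 2 by rewrite invfM mulrC.
    lra.
  rewrite mulrC ltr_pdivlMr // => lt1; rewrite mulrC => le1.
  by have := le_lt_trans le1 lt1; rewrite ltxx.
exists k1; split=> // j _; rewrite leNgt; apply/negP => jbad; apply: nobad.
by exists j.
Qed.

(** For the exceptional eigenvalue of multiplicity m, m factors contribute at least c/|A| each and
    the other n - m at least c |A| each. *)
Lemma prod_root_norm_ge x : (exists k j, x k != x j) ->
    (forall k, ((multiplicity x k).*2 <= n)%N) ->
  exists c : R, 0 < c /\ forall A, \det A = 1 -> exists k,
    c * norm2 A ^+ (n - (multiplicity x k).*2) <= \prod_k root_norm A x k.
Proof.
move=> /root_norm_dichotomy[c [c0 Hc]] mult; exists (c ^+ n).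
split=> [|A detA]; first exact: exprn_gt0.
have [k [Hk Hall]] := Hc A detA; exists k; have mk := mult k.
have A1 := norm2_ge1 detA; have A0 : 0 < norm2 A by apply: lt_le_trans A1.
rewrite (bigID (fun j => x j == x k)) /=.
pose m := multiplicity x k; rewrite -/m in mk *.
have cm : #|[pred j | x j == x k]| = m := card_multiplicity x k.
have cm' : #|[pred j | x j != x k]| = (n - m)%N := card_neq_multiplicity x k.
apply: (@le_trans _ _ ((c / norm2 A) ^+ m * (c * norm2 A) ^+ (n - m))).
  have -> : (n - m = m + (n - m.*2))%N by lia.
  rewrite exprMn [(c * _) ^+ _]exprMn exprVn [norm2 A ^+ (_ + _)]exprD.
  rewrite [leRHS](_ : _ = (c ^+ m * c ^+ (m + (n - m.*2))) *
    (norm2 A ^+ m / norm2 A ^+ m) * norm2 A ^+ (n - m.*2)); last by ring.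
  rewrite divff ?expf_neq0 ?(lt0r_neq0 A0) // mulr1 -exprD.
  by have -> : (m + (m + (n - m.*2)) = n)%N by lia.
rewrite -cm' -cm -!prodr_const; apply: ler_pM.
- by apply: prodr_ge0 => j _; rewrite divr_ge0 // ltW.
- by apply: prodr_ge0 => j _; rewrite mulr_ge0 // ltW.
- by apply: ler_prod => j _; rewrite divr_ge0 ?Hall // ltW.
by apply: ler_prod => j nj; rewrite mulr_ge0 ?Hk // ltW.
Qed.

End PencilForm.

(** * Limits of bounded sequences of group elements *)

Section UltrafilterLimits.
Local Open Scope classical_set_scope.
Local Open Scope ring_scope.
Variables (R : realType) (U : set_system nat).
Hypotheses (UU : UltraFilter U) (U_oo : (eventually `<=` U)%classic).
Local Notation C := (R[i])%C.
Implicit Types z w : C.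

(** Segments are compact, and a cluster point of an ultrafilter is a limit. *)
Lemma bounded_ultra_cvg (u : nat -> R) (M : R) : (forall t, `|u t| <= M) ->
  exists l : R, u @ U --> l.
Proof.
move=> uM.
have [|l [_ cl]] := @segment_compact R (- M) M (u @ U) _.
  apply: (@filterS _ U _ setT); last exact: filterT.
  move=> t _ /=.
  by rewrite in_itv /= -ler_norml; apply: uM.
exists l => B lB; have [//|UB] := in_ultra_setVsetC (u @^-1` B)%classic UU.
by have [y [nB By]] := cl (~` B)%classic B UB lB.
Qed.

Lemma Re_add z w : complex.Re (z + w) = complex.Re z + complex.Re w.
Proof. by case: z; case: w. Qed.
Lemma Im_add z w : complex.Im (z + w) = complex.Im z + complex.Im w.
Proof. by case: z; case: w. Qed.
Lemma Re_mul z w : complex.Re (z * w) =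
  complex.Re z * complex.Re w - complex.Im z * complex.Im w.
Proof. by case: z; case: w. Qed.
Lemma Im_mul z w : complex.Im (z * w) =
  complex.Re z * complex.Im w + complex.Im z * complex.Re w.
Proof. by case: z; case: w. Qed.

Lemma cnorm_ge_Re z : `|complex.Re z| <= cnorm z.
Proof.
case: z => a b; rewrite /cnorm /= -sqrtr_sqr ler_wsqrtr // lerDl.
exact: sqr_ge0.
Qed.
Lemma cnorm_ge_Im z : `|complex.Im z| <= cnorm z.
Proof.
case: z => a b; rewrite /cnorm /= -sqrtr_sqr ler_wsqrtr // lerDr.
exact: sqr_ge0.
Qed.

(* A function on [option nat] encodes a sequence together with its value at
   infinity, so that continuity there is a property closed under ring operations. *)
Definition continuous_at_None (f : option nat -> C) :=
  (fun t => complex.Re (f (Some t))) @ U --> complex.Re (f None) /\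
  (fun t => complex.Im (f (Some t))) @ U --> complex.Im (f None).

Lemma continuous_at_None_subring : fun_subring continuous_at_None.
Proof.
split=> [c|f g [fr fi] [gr gi]|f g [fr fi] [gr gi]].
- by split; apply: cvg_cst.
- by split; [under eq_cvg do rewrite Re_add; rewrite Re_add; apply: cvgD
           | under eq_cvg do rewrite Im_add; rewrite Im_add; apply: cvgD].
- split; [under eq_cvg do rewrite Re_mul; rewrite Re_mul; apply: cvgB
         | under eq_cvg do rewrite Im_mul; rewrite Im_mul; apply: cvgD];
  exact: cvgM.
Qed.

(** Uniqueness of limits: carries an identity that holds along the sequence over to the limit. *)
Lemma continuous_at_None_cst f c : continuous_at_None f ->
  (forall t, f (Some t) = c) -> f None = c.
Proof.
move=> [fr fi] fc.
have er : complex.Re (f None) = complex.Re c.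
  apply: (norm_cvg_unique fr).
  rewrite (_ : (fun t => _) = fun=> complex.Re c); first exact: cvg_cst.
  by apply: funext => t; rewrite fc.
have ei : complex.Im (f None) = complex.Im c.
  apply: (norm_cvg_unique fi).
  rewrite (_ : (fun t => _) = fun=> complex.Im c); first exact: cvg_cst.
  by apply: funext => t; rewrite fc.
by case: (f None) c er ei {fc} => a b [a' b'] /= -> ->.
Qed.

Lemma bounded_continuous_at_None (f : nat -> C) M : (forall t, cnorm (f t) <= M) ->
  exists l, continuous_at_None (fun o => if o is Some t then f t else l).
Proof.
move=> fM.
have [a ra] := @bounded_ultra_cvg (fun t => complex.Re (f t)) M
  (fun t => le_trans (cnorm_ge_Re _) (fM t)).
have [b ib] := @bounded_ultra_cvg (fun t => complex.Im (f t)) M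
  (fun t => le_trans (cnorm_ge_Im _) (fM t)).
by exists (a +i* b)%C.
Qed.

Lemma close_continuous_at_None f :
  (forall t, cnorm (f (Some t) - f None) <= t.+1%:R^-1) -> continuous_at_None f.
Proof.
move=> close; split; apply/cvgrPdist_le => e e0; apply: U_oo;
  apply: filterS (near_infty_natSinv_lt (PosNum e0)) => t /= /ltW lt_e;
  apply: le_trans lt_e; apply: le_trans (close t).
  rewrite distrC (_ : complex.Re _ - _ = complex.Re (f (Some t) - f None)).
    exact: cnorm_ge_Re.
  by case: (f (Some t)); case: (f None).
rewrite distrC (_ : complex.Im _ - _ = complex.Im (f (Some t) - f None)).
  exact: cnorm_ge_Im.
by case: (f (Some t)); case: (f None).
Qed.

End UltrafilterLimits.

(** * Conjugacy to a given diagonal matrix by a matrix of determinant 1 *)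

Section ConjugateDiagonal.
Variables (F : numClosedFieldType) (n : nat).

Lemma unit_det1_exponent (M : 'M[F]_n.+1) : M \in unitmx ->
  exists c, \det (c *: M) = 1.
Proof.
rewrite unitmxE unitfE => dM; exists (n.+1.-root (\det M)^-1).
by rewrite detZ rootCK // mulVf.
Qed.

Lemma conj_scale (c : F) (B X : 'M[F]_n.+1) : c != 0 -> B \in unitmx ->
  (c *: B) *m X *m invmx (c *: B) = B *m X *m invmx B.
Proof.
move=> c0 Bu; rewrite invmxZ ?scaler_unit ?unitfE // -!scalemxAl -scalemxAr.
by rewrite scalerA mulfV // scale1r.
Qed.

(* A matrix annihilated by a split polynomial with simple roots is
   diagonalizable, and its characteristic polynomial fixes its diagonal form. *)
Lemma diagonal_conj (N : 'M[F]_n.+1) (x : 'I_n.+1 -> F) :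
    horner_mx N (\prod_(v <- undup [seq x k | k <- enum 'I_n.+1]) ('X - v%:P)) = 0 ->
    (forall z, \det (z%:M - N) = \prod_k (z - x k)) ->
  exists B, \det B = 1 /\ N = B *m diag_mx (\row_k x k) *m invmx B.
Proof.
move=> /mxminpoly_min minN detN.
have /diagonalizableP[Q Qu /(diagonalizable_forLR Qu)[d Nd]] :
    exists2 rs, uniq rs & mxminpoly N %| \prod_(v <- rs) ('X - v%:P).
  by exists (undup [seq x k | k <- enum 'I_n.+1]) => //; apply: undup_uniq.
have {}Nd : N = invmx Q *m diag_mx d *m Q.
  by rewrite Nd mxpoly.conjumx ?unitmx_inv // invmxK.
have prodE z : \prod_k (z - d 0 k) = \prod_k (z - x k).
  have -> : \prod_k (z - x k) = \det (invmx Q *m (z%:M - diag_mx d) *m Q).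
    rewrite -detN Nd mulmxBr mulmxBl mul_mx_scalar -scalemxAl mulVmx //.
    by rewrite scalemx1.
  rewrite !det_mulmx mulrAC -det_mulmx mulVmx // det1 mul1r -diag_const_mx.
  by rewrite -linearB det_diag; apply: eq_bigr => k _; rewrite !mxE.
(* Two split monic polynomials with equal values have the same multiset of roots, so [d] is [x] up
   to a permutation, realized by a permutation matrix. *)
have : perm_eq [tuple d 0 k | k < n.+1] [tuple x k | k < n.+1].
  apply: prod_XsubC_eq; apply/eqP; rewrite -subr_eq0.
  apply: contrapT => /negP/poly_nonroot[z].
  rewrite hornerD hornerN !horner_prod !big_map -enumT.
  under eq_bigr do rewrite hornerXsubC; rewrite big_enum /=.
  under [X in _ - X]eq_bigr do rewrite hornerXsubC; rewrite [X in _ - X]big_enum /=.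
  by rewrite prodE subrr eqxx.
move/tuple_permP => [p dp].
have dxp k : d 0 k = x (p k).
  have := congr1 (fun s => nth 0 s k) dp.
  by rewrite -!tnth_nth !tnth_mktuple.
have dP : diag_mx d *m perm_mx p = perm_mx p *m diag_mx (\row_k x k).
  rewrite mul_diag_mx mul_mx_diag; apply/matrixP => i j; rewrite !mxE dxp.
  by case: eqP => [<-|]; rewrite ?mulr1 ?mul1r ?mulr0 ?mul0r.
pose M := invmx Q *m perm_mx p.
have Mu : M \in unitmx by rewrite unitmx_mul unitmx_inv Qu unitmx_perm.
have NM : N *m M = M *m diag_mx (\row_k x k).
  by rewrite /M Nd -!mulmxA mulKVmx // dP.
have [c cM] := unit_det1_exponent Mu; exists (c *: M); split=> //.
have c0 : c != 0.
  apply/eqP => c0; move/eqP: cM; rewrite c0 scale0r det0.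
  by rewrite eq_sym oner_eq0.
by rewrite conj_scale // -NM mulmxK.
Qed.

End ConjugateDiagonal.

Section BoundedClosure.
Variables (R : realType) (n : nat).
Local Notation C := (R[i])%C.
Implicit Types (x : 'I_n.+1 -> C).

Lemma inverse2_comb (K : comPzRingType) m (a b c d : K) (X Y : 'M[K]_m) :
  a * d - b * c = 1 ->
  d *: (a *: X + b *: Y) + (- b) *: (c *: X + d *: Y) = X /\
  (- c) *: (a *: X + b *: Y) + a *: (c *: X + d *: Y) = Y.
Proof.
move=> det1; split; apply/matrixP => i j; rewrite !mxE;
  rewrite -[RHS]mul1r -det1; ring.
Qed.

(* The limit of A exists along an ultrafilter; undoing it, B R B^-1 converges to a
   matrix that still satisfies the minimal and characteristic equations of the
   diagonal matrix R, hence is conjugate to it. *)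
Lemma bounded_closure_in_orbit x (phi : state R n.+1) (M : R) :
    (forall d : R, 0 < d -> exists A B D, inG A B D /\ norm2 A <= M /\
       forall i j, cnorm ((act A B D (pencil_state x)).1 i j - phi.1 i j) <= d /\
                   cnorm ((act A B D (pencil_state x)).2 i j - phi.2 i j) <= d) ->
  Defs.in_orbit (pencil_state x) phi.
Proof.
move=> H; pose X : 'M[C]_n.+1 := diag_mx (\row_k x k).
have {}H t : exists g : 'M[C]_2 * ('M[C]_n.+1 * 'M[C]_n.+1),
    inG g.1 g.2.1 g.2.2 /\ norm2 g.1 <= M /\
    forall i j,
      cnorm ((act g.1 g.2.1 g.2.2 (pencil_state x)).1 i j - phi.1 i j) <= t.+1%:R^-1 /\
      cnorm ((act g.1 g.2.1 g.2.2 (pencil_state x)).2 i j - phi.2 i j) <= t.+1%:R^-1.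
  have [|A [B [D g]]] := H t.+1%:R^-1; first by rewrite invr_gt0.
  by exists (A, (B, D)).
have /choice[g Hg] := H.
have [U [UU U_oo]] := ultraFilterLemma eventually_filter.
have S := @continuous_at_None_subring R U UU.
pose st t := act (g t).1 (g t).2.1 (g t).2.2 (pencil_state x).
pose P o := if o is Some t then (st t).1 else phi.1.
pose Q o := if o is Some t then (st t).2 else phi.2.
have SP : mx_in (continuous_at_None U) P.
  move=> i j; apply: close_continuous_at_None => // t.
  by have [_ [_ /(_ i j)[]]] := Hg t.
have SQ : mx_in (continuous_at_None U) Q.
  move=> i j; apply: close_continuous_at_None => // t.
  by have [_ [_ /(_ i j)[]]] := Hg t.
have gM i j t : cnorm ((g t).1 i j) <= M.
  have [_ [leM _]] := Hg t; apply: le_trans leM; rewrite /norm2.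
  have := cnorm_ge0 ((g t).1 0 0); have := cnorm_ge0 ((g t).1 0 1).
  have := cnorm_ge0 ((g t).1 1 0); have := cnorm_ge0 ((g t).1 1 1).
  by elim/ord2_ind: i; elim/ord2_ind: j; lra.
have /choice[lim_entry Hlim] : forall ij : 'I_2 * 'I_2, exists l,
    continuous_at_None U (fun o => if o is Some t then (g t).1 ij.1 ij.2 else l).
  by move=> [i j]; apply: bounded_continuous_at_None (gM i j).
pose A o : 'M[C]_2 :=
  if o is Some t then (g t).1 else \matrix_(i, j) lim_entry (i, j).
have SA : mx_in (continuous_at_None U) A.
  move=> i j; have := Hlim (i, j); congr (continuous_at_None U _).
  by apply: funext => -[t|] //=; rewrite mxE.
(* [R'] and [S'] apply the inverse of [A o]: along the sequence they are B X D^T and B D^T. They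
   converge although no bound on B and D is known. *)
pose R' o := A o 1 1 *: P o + (- A o 0 1) *: Q o.
pose S' o := (- A o 1 0) *: P o + A o 0 0 *: Q o.
have SR' : mx_in (continuous_at_None U) R'.
  by apply: (mx_inD S); apply: (mx_inZ S) => //; apply: (subringN S).
have SS' : mx_in (continuous_at_None U) S'.
  by apply: (mx_inD S); apply: (mx_inZ S) => //; apply: (subringN S).
(* Since [S'] has determinant 1, the adjugate is its inverse and [N] is B X B^-1 along the sequence,
   free of D. *)
pose N o := R' o *m \adj (S' o).
have SN : mx_in (continuous_at_None U) N.
  by apply: (mx_inM S) => //; apply: (mx_in_adj S).
have detA o : \det (A o) = 1.
  have dt t : \det (A (Some t)) = 1 by have [[]] := Hg t.
  by case: o => // ; apply: (continuous_at_None_cst UU (subring_det S SA) dt).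
have RS t : R' (Some t) = (g t).2.1 *m X *m (g t).2.2^T /\
            S' (Some t) = (g t).2.1 *m (g t).2.2^T.
  have := detA (Some t); rewrite mx22_det => d1.
  have [e1 e2] := inverse2_comb ((g t).2.1 *m X *m (g t).2.2^T)
    ((g t).2.1 *m 1%:M *m (g t).2.2^T) d1.
  by split; [apply: e1 | rewrite -[X in X *m _^T](mulmx1 (g t).2.1); apply: e2].
have detS o : \det (S' o) = 1.
  have dt t : \det (S' (Some t)) = 1.
    have [_ ->] := RS t; rewrite det_mulmx det_tr.
    by have [[_ [-> ->]]] := Hg t; rewrite mulr1.
  by case: o => //; apply: (continuous_at_None_cst UU (subring_det S SS') dt).
have Bu t : (g t).2.1 \in unitmx.
  by rewrite unitmxE; have [[_ [-> _]]] := Hg t; rewrite unitr1.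
have Nt t : N (Some t) = (g t).2.1 *m X *m invmx (g t).2.1.
  have Sadj : S' (Some t) *m \adj (S' (Some t)) = 1%:M by rewrite mul_mx_adj detS.
  have [eR eS] := RS t; rewrite /N eR.
  rewrite (_ : _ *m (g t).2.2^T = (g t).2.1 *m X *m invmx (g t).2.1 *m S' (Some t)).
    by rewrite -mulmxA Sadj mulmx1.
  by rewrite eS mulmxA mulmxKV.
have detN z : \det (z%:M - N None) = \prod_k (z - x k).
  have SzN : mx_in (continuous_at_None U) (fun o => z%:M + (-1) *: N o).
    apply: (mx_inD S); first exact: (mx_in_cst S).
    by apply: (mx_inZ S) => //; apply: (subring_cst S).
  rewrite -scaleN1r; apply: (continuous_at_None_cst UU (subring_det S SzN)) => t.
  rewrite Nt scaleN1r.
  have -> : z%:M - (g t).2.1 *m X *m invmx (g t).2.1 =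
      (g t).2.1 *m (z%:M - X) *m invmx (g t).2.1.
    rewrite mulmxBr mulmxBl mul_mx_scalar -scalemxAl mulmxV //.
    by rewrite scalemx1.
  rewrite !det_mulmx mulrAC -det_mulmx mulmxV // det1 mul1r -diag_const_mx.
  by rewrite -linearB det_diag; apply: eq_bigr => k _; rewrite !mxE.
pose p : {poly C} := \prod_(v <- undup [seq x k | k <- enum 'I_n.+1]) ('X - v%:P).
have pE o : horner_mx (N o) p =
    \prod_(v <- undup [seq x k | k <- enum 'I_n.+1]) (N o + (-1) *: v%:M).
  rewrite rmorph_prod; apply: eq_bigr => v _.
  by rewrite rmorphB /= horner_mx_X horner_mx_C scaleN1r.
have minN : horner_mx (N None) p = 0.
  have Sp : mx_in (continuous_at_None U) (fun o => horner_mx (N o) p).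
    rewrite (_ : (fun o => _) = (fun o =>
      \prod_(v <- undup [seq x k | k <- enum 'I_n.+1]) (N o + (-1) *: v%:M))).
      apply: (mx_in_prod S) => v; apply: (mx_inD S) => //.
      exact: (mx_in_cst S).
    by apply: funext => o; rewrite pE.
  apply/matrixP => i j; rewrite [RHS]mxE.
  apply: (continuous_at_None_cst UU (Sp i j)) => t.
  rewrite Nt horner_mx_uconj ?Bu // horner_mx_diag.
  rewrite (_ : map_mx _ _ = 0) ?linear0 ?mulmx0 ?mul0mx ?mxE //.
  apply/rowP => k; rewrite !mxE; apply/eqP; rewrite -/(root p (x k)).
  by rewrite root_prod_XsubC mem_undup; apply: map_f; rewrite mem_enum.
have [B [detB NB]] := diagonal_conj minN detN.
have Bu' : B \in unitmx by rewrite unitmxE detB unitr1.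
(* The third factor is chosen so that B D^T is the limit of [S']; then B X D^T = N S' is the limit
   of [R']. *)
exists (A None), B, (invmx B *m S' None)^T; split.
  split; first exact: detA; split=> //.
  by rewrite det_tr det_mulmx detS det_inv detB invr1 mulr1.
have eR : R' None = N None *m S' None.
  by rewrite /N -mulmxA mul_adj_mx detS mulmx1.
have e1 : B *m X *m (invmx B *m S' None) = R' None by rewrite mulmxA -NB -eR.
have e2 : B *m (invmx B *m S' None) = S' None by rewrite mulKVmx.
rewrite /act trmxK /= mulmx1 e1 e2.
have := detA None; rewrite mx22_det => d1.
have [|p1 p2] := @inverse2_comb _ _ (A None 1 1) (- A None 0 1) (- A None 1 0)
  (A None 0 0) phi.1 phi.2; first by rewrite -[RHS]d1; ring.
rewrite !opprK in p1 p2; rewrite [phi]surjective_pairing.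
by congr pair; [apply: p1 | apply: p2].
Qed.

End BoundedClosure.

(** * Semistable and polystable pencils *)

Section Semistability.
Variables (R : realType) (n : nat).
Local Notation C := (R[i])%C.
Implicit Types x : 'I_n -> C.

Lemma expr_le_id (t : R) k : 0 <= t <= 1 -> (0 < k)%N -> t ^+ k <= t.
Proof.
case/andP=> t0 t1; case: k => // k _; rewrite exprS -[leRHS]mulr1 ler_wpM2l //.
exact: exprn_ile1.
Qed.

Lemma semistable_pencil x : (exists k j, x k != x j) ->
  (forall k, ((multiplicity x k).*2 <= n)%N) -> semistable (pencil_state x).
Proof.
move=> dist mult /in_orbit_closureP null.
have n0 : (0 < n)%N by have [k _] := dist; apply: leq_ltn_trans (ltn_ord k).
have [c [c0 Hc]] := prod_root_norm_ge dist mult.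
pose q : R := (n.*2.+4%:R^-1) ^+ n.
have q0 : 0 < q by rewrite exprn_gt0 // invr_gt0 ltr0n.
have f0 : 0 < n`!%:R :> R by rewrite ltr0n fact_gt0.
(* Makes n! ((n + 1) d)^n at most q c / 2, contradicting the lower bound q c; the minimum with 1
   allows the n-th power to be dropped. *)
pose d : R := Num.min 1 (q * c / (2 * n`!%:R)) / n.+1%:R.
have n1 : 0 < n.+1%:R :> R by rewrite ltr0n.
have d0 : 0 < d.
  by rewrite divr_gt0 // lt_min ltr01 divr_gt0 // mulr_gt0.
have [A [B [D [g bnd]]]] := null d d0.
have [k lek] := Hc A g.1.
have bnd' i j : cnorm ((act A B D (pencil_state x)).1 i j) <= d /\
    cnorm ((act A B D (pencil_state x)).2 i j) <= d.
  have z1 : (zero_state R n).1 i j = 0 by rewrite mxE.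
  have z2 : (zero_state R n).2 i j = 0 by rewrite mxE.
  by have := bnd i j; rewrite z1 ?z2 !subr0.
have := prod_root_norm_act g bnd'; rewrite -/q => le1.
have le2 : c <= \prod_k root_norm A x k.
  apply: le_trans lek; rewrite ler_peMr ?(ltW c0) // exprn_ege1 //.
  exact: norm2_ge1 g.1.
have nd : n.+1%:R * d = Num.min 1 (q * c / (2 * n`!%:R)).
  by rewrite /d mulrC divfK // gt_eqF.
have le3 : (n.+1%:R * d) ^+ n <= q * c / (2 * n`!%:R).
  apply: (@le_trans _ _ (n.+1%:R * d)); last by rewrite nd ge_min lexx orbT.
  by apply: expr_le_id; rewrite // nd ge_min lexx andbT -nd mulr_ge0 // ltW.
have : q * c <= n`!%:R * (q * c / (2 * n`!%:R)).
  apply: (@le_trans _ _ (q * \prod_k root_norm A x k)).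
    by rewrite ler_wpM2l // ltW.
  by apply: (le_trans le1); rewrite ler_wpM2l // ltW.
have -> : n`!%:R * (q * c / (2 * n`!%:R)) = q * c / 2 by field; rewrite gt_eqF.
have := mulr_gt0 q0 c0; lra.
Qed.

End Semistability.

Section ClosedOrbits.
Variables (R : realType) (n : nat).
Local Notation C := (R[i])%C.
Implicit Types x : 'I_n -> C.

Lemma entry_le_sum (K : numDomainType) m p (f : 'I_m -> 'I_p -> K) i j :
  (forall k l, 0 <= f k l) -> f i j <= \sum_k \sum_l f k l.
Proof.
move=> f0; have l1 : f i j <= \sum_l f i l by rewrite (bigD1 j) //= lerDl sumr_ge0.
apply: (le_trans l1); rewrite [leRHS](bigD1 i) //= lerDl sumr_ge0 // => k _.
by rewrite sumr_ge0.
Qed.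

Lemma prod_root_norm_bounded x (phi : state R n) : exists K : R, forall A B D,
    inG A B D ->
    (forall i j, cnorm ((act A B D (pencil_state x)).1 i j - phi.1 i j) <= 1 /\
                 cnorm ((act A B D (pencil_state x)).2 i j - phi.2 i j) <= 1) ->
  \prod_k root_norm A x k <= K.
Proof.
pose f i j := cnorm (phi.1 i j) + cnorm (phi.2 i j).
have f0 i j : 0 <= f i j by rewrite addr_ge0 ?cnorm_ge0.
(* Bounds every entry of every state within entrywise distance 1 of [phi]. *)
pose e := 1 + \sum_i \sum_j f i j.
pose q : R := (n.*2.+4%:R^-1) ^+ n.
have q0 : 0 < q by rewrite exprn_gt0 // invr_gt0 ltr0n.
exists (n`!%:R * (n.+1%:R * e) ^+ n / q) => A B D g close.
rewrite ler_pdivlMr // mulrC; apply: (prod_root_norm_act g) => i j.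
have [c1 c2] := close i j; have := entry_le_sum i j f0; rewrite /e /f => lef.
have := cnorm_ge0 (phi.1 i j); have := cnorm_ge0 (phi.2 i j).
move=> p1 p2; split.
  rewrite -[X in cnorm X](subrK (phi.1 i j)); apply: (le_trans (cnormD _ _)); lra.
rewrite -[X in cnorm X](subrK (phi.2 i j)); apply: (le_trans (cnormD _ _)); lra.
Qed.

Lemma closure_close x (phi : state R n) : in_orbit_closure (pencil_state x) phi ->
  forall d : R, 0 < d -> exists A B D, inG A B D /\
    (forall i j, cnorm ((act A B D (pencil_state x)).1 i j - phi.1 i j) <= 1 /\
                 cnorm ((act A B D (pencil_state x)).2 i j - phi.2 i j) <= 1) /\
    forall i j, cnorm ((act A B D (pencil_state x)).1 i j - phi.1 i j) <= d /\
                cnorm ((act A B D (pencil_state x)).2 i j - phi.2 i j) <= d.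
Proof.
move/in_orbit_closureP => H d d0; have [|A [B [D [g le_min]]]] := H (Num.min 1 d).
  by rewrite lt_min ltr01.
exists A, B, D; split=> //; split=> i j; have [l1 l2] := le_min i j.
  by split; [apply: (le_trans l1) | apply: (le_trans l2)]; rewrite ge_min lexx.
by split; [apply: (le_trans l1) | apply: (le_trans l2)];
  rewrite ge_min lexx orbT.
Qed.

End ClosedOrbits.

Section Polystability.
Variables (R : realType) (n : nat).
Local Notation C := (R[i])%C.
Implicit Types x : 'I_n.+1 -> C.

(** The strict inequality makes the exponent of |A| in [prod_root_norm_ge] positive, so a bound on
    the product of root norms bounds |A|. *)
Lemma polystable_pencil x : (exists k j, x k != x j) ->
  (forall k, ((multiplicity x k).*2 < n.+1)%N) -> polystable (pencil_state x).
Proof.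
move=> dist mult; have multW k := ltnW (mult k); split.
  exact: semistable_pencil.
move=> phi cl; have [K HK] := prod_root_norm_bounded x phi.
have [c [c0 Hc]] := prod_root_norm_ge dist multW.
apply: (@bounded_closure_in_orbit _ _ _ _ (K / c)) => d d0.
have [A [B [D [g [c1 cd]]]]] := closure_close cl d0; exists A, B, D; split=> //.
split=> //; rewrite ler_pdivlMr // mulrC.
have [k lek] := Hc A g.1; apply: le_trans (HK _ _ _ g c1).
apply: le_trans lek; rewrite ler_pM2l //; apply: ler_eXnr.
  by rewrite subn_gt0.
exact: norm2_ge1 g.1.
Qed.

Lemma mulmx22E (K : pzSemiRingType) (A A' : 'M[K]_2) i j :
  (A *m A') i j = A i 0 * A' 0 j + A i 1 * A' 1 j.
Proof.
rewrite mxE !big_ord_recl big_ord0 addr0.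
by congr (_ * _ + A i _ * A' _ j); apply: val_inj.
Qed.

Lemma mulmx_comb_comp (K : comPzRingType) m (a b c d e f : K)
    (B B' P Q D D' : 'M[K]_m) :
  a *: (B *m (c *: (B' *m P *m D') + d *: (B' *m Q *m D')) *m D) +
  b *: (B *m (e *: (B' *m P *m D') + f *: (B' *m Q *m D')) *m D) =
  (a * c + b * e) *: (B *m B' *m P *m (D' *m D)) +
  (a * d + b * f) *: (B *m B' *m Q *m (D' *m D)).
Proof.
rewrite !mulmxDr !mulmxDl -!scalemxAr -!scalemxAl !scalerDr !scalerA addrACA.
by rewrite -!scalerDl !mulmxA.
Qed.

Lemma act_comp (A A' : 'M[C]_2) (B B' D D' : 'M[C]_n.+1) (s : state R n.+1) :
  act A B D (act A' B' D' s) = act (A *m A') (B *m B') (D *m D') s.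
Proof.
rewrite /act trmx_mul !mulmx22E.
by congr pair; exact: mulmx_comb_comp.
Qed.

(* For two eigenvalues the stabilizer contains a torus of SL(2) rescaling the two
   root vectors inversely; it is used to give them equal norms. *)
Lemma balancing_element x (k1 k2 : 'I_n.+1) (c : C) :
    x k1 != x k2 -> (forall k, x k = x k1 \/ x k = x k2) ->
    (multiplicity x k1).*2 = n.+1 -> c != 0 ->
  exists T B0, inG T B0 1%:M /\ act T B0 1%:M (pencil_state x) = pencil_state x /\
    forall A, root_norm (A *m T) x k1 = cnorm c * root_norm A x k1 /\
              root_norm (A *m T) x k2 = (cnorm c)^-1 * root_norm A x k2.
Proof.
move=> n12 two mult c0; set a := x k1 in n12 two *; set b := x k2 in n12 two *.
have ab : a - b != 0 by rewrite subr_eq0.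
(* [T] has eigenvectors (a, 1) and (b, 1) with eigenvalues c and 1/c. *)
pose T : 'M[C]_2 := \matrix_(i, j)
  if i == 0 then if j == 0 then (a * c - b / c) / (a - b)
                 else a * b * (c^-1 - c) / (a - b)
  else if j == 0 then (c - c^-1) / (a - b) else (a / c - b * c) / (a - b).
have [T00 T01 T10 T11] : [/\ T 0 0 = (a * c - b / c) / (a - b),
    T 0 1 = a * b * (c^-1 - c) / (a - b), T 1 0 = (c - c^-1) / (a - b)
    & T 1 1 = (a / c - b * c) / (a - b)] by split; rewrite mxE.
pose lam k := if x k == a then c else c^-1.
have rv1 k : root_vec1 T x k = lam k * x k.
  rewrite /root_vec1 T00 T01 /lam; case: (two k) => ->; first rewrite eqxx.
    by field; rewrite ?c0 ?ab.
  by rewrite eq_sym (negPf n12); field; rewrite c0.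
have rv2 k : root_vec2 T x k = lam k.
  rewrite /root_vec2 T10 T11 /lam; case: (two k) => ->; first rewrite eqxx.
    by field; rewrite ?c0 ?ab.
  by rewrite eq_sym (negPf n12); field; rewrite c0.
have lam0 k : lam k != 0 by rewrite /lam; case: ifP; rewrite ?invr_eq0.
(* Undoes the rescaling by [T]; its determinant is 1 because both eigenvalues have the same
   multiplicity. *)
pose B0 : 'M[C]_n.+1 := diag_mx (\row_k (lam k)^-1).
exists T, B0; split; [split; [|split] | split].
- by rewrite mx22_det T00 T01 T10 T11; field; rewrite ?c0 ?ab.
- rewrite det_diag (eq_bigr (fun k => (lam k)^-1)) => [|k _]; last by rewrite mxE.
  rewrite prodfV (bigID (fun k => x k == a)) /=.
  rewrite (eq_bigr (fun=> c)) => [|k xk]; last by rewrite /lam xk.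
  rewrite [X in _ * X](eq_bigr (fun=> c^-1)) => [|k xk]; last by rewrite /lam (negPf xk).
  rewrite !prodr_const.
  have cm := card_multiplicity x k1; have := card_neq_multiplicity x k1.
  rewrite (_ : (n.+1 - _)%N = multiplicity x k1) => [cm'|]; last by lia.
  by rewrite cm cm' exprVn mulfV ?invr1 // expf_neq0.
- exact: det1.
- rewrite act_pencil trmx1 !mulmx1 /pencil_state.
  congr pair; rewrite mul_diag_mx; apply/matrixP => i j; rewrite !mxE.
    by rewrite rv1 mulrnAr mulKf.
  by rewrite rv2 mulrnAr mulVf.
have rvA A k : root_norm (A *m T) x k = cnorm (lam k) * root_norm A x k.
  rewrite /root_norm mulrDr -!cnormM; congr (cnorm _ + cnorm _).
    transitivity (A 0 0 * root_vec1 T x k + A 0 1 * root_vec2 T x k).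
      by rewrite /root_vec1 /root_vec2 !mulmx22E; ring.
    by rewrite rv1 rv2 /root_vec1; ring.
  transitivity (A 1 0 * root_vec1 T x k + A 1 1 * root_vec2 T x k).
    by rewrite /root_vec1 /root_vec2 !mulmx22E; ring.
  by rewrite rv1 rv2 /root_vec2; ring.
move=> A; rewrite !rvA /lam -/a -/b eqxx eq_sym (negPf n12).
by rewrite /cnorm ComplexField.Normc.normcV.
Qed.

(** The exponent of |A| in [prod_root_norm_ge] is now 0, so the product of root norms does not bound
    [A]. After balancing, all root norms equal one number N with N^(n+1) <= K, and [norm2_le] bounds
    the new [A]. *)
Lemma polystable_two_roots x (k1 k2 : 'I_n.+1) :
    x k1 != x k2 -> (forall k, x k = x k1 \/ x k = x k2) ->
    (forall k, (multiplicity x k).*2 = n.+1) -> polystable (pencil_state x).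
Proof.
move=> n12 two mult; split.
  by apply: semistable_pencil => [|k]; [exists k1, k2 | rewrite mult].
move=> phi cl; have [K HK] := prod_root_norm_bounded x phi.
have n0 : 0 < cnorm (x k1 - x k2) by rewrite cnorm_gt0 subr_eq0.
apply: (@bounded_closure_in_orbit _ _ _ _
  ((1 + cnorm (x k1) + cnorm (x k2)) * (2 * (1 + `|K|)) / cnorm (x k1 - x k2))) => d d0.
have [A [B [D [g [c1 cd]]]]] := closure_close cl d0.
have rn1 := root_norm_gt0 g.1 n12.
have rn2 : 0 < root_norm A x k2 by apply: (root_norm_gt0 g.1 (j := k1)); rewrite eq_sym.
(* The solution of r |w_k1| = |w_k2| / r. *)
pose r := Num.sqrt (root_norm A x k2 / root_norm A x k1).
have r0 : 0 < r by rewrite sqrtr_gt0 divr_gt0.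
have r2 : r ^+ 2 = root_norm A x k2 / root_norm A x k1.
  by rewrite sqr_sqrtr // ltW // divr_gt0.
have rc : cnorm r%:C%C = r by rewrite cnormR // ltW.
have rc0 : r%:C%C != 0 by rewrite -cnorm_eq0 rc gt_eqF.
have [T [B0 [gT [fixT normT]]]] := balancing_element n12 two (mult k1) rc0.
have actT : act (A *m T) (B *m B0) (D *m 1%:M) (pencil_state x) =
    act A B D (pencil_state x) by rewrite -act_comp fixT.
have gAT : inG (A *m T) (B *m B0) (D *m 1%:M).
  case: g => gA [gB gD]; case: gT => gT [gB0 _]; split; last split.
  - by rewrite det_mulmx gA gT mulr1.
  - by rewrite det_mulmx gB gB0 mulr1.
  by rewrite mulmx1.
exists (A *m T), (B *m B0), (D *m 1%:M); rewrite actT.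
split; [exact: gAT | split; [| exact: cd]].
have [N1 N2] := normT A; rewrite rc in N1 N2.
have N12 : root_norm (A *m T) x k2 = root_norm (A *m T) x k1.
  have rneq0 := lt0r_neq0 r0; rewrite N1 N2; apply: (mulfI rneq0).
  by rewrite mulVKf // mulrA -expr2 r2 divfK // lt0r_neq0.
have Nall k : root_norm (A *m T) x k = root_norm (A *m T) x k1.
  by case: (two k) => xk; [|rewrite -N12]; rewrite /root_norm /root_vec1 /root_vec2 xk.
set N := root_norm (A *m T) x k1 in N12 Nall *.
have N0 : 0 <= N := root_norm_ge0 _ _ _.
have NK : N ^+ n.+1 <= K.
  rewrite -[X in _ ^+ X]card_ord -prodr_const.
  rewrite -(eq_bigr _ (fun k _ => Nall k)).
  by apply: (HK _ _ _ gAT); rewrite actT.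
have N1K : N <= 1 + `|K|.
  have [N1'|/ltW N1'] := leP N 1; first by apply: (le_trans N1'); rewrite lerDl.
  have : N <= K by apply: le_trans NK; rewrite ler_eXnr.
  by move=> NleK; apply: (le_trans NleK); apply: (le_trans (ler_norm K)); rewrite lerDr.
rewrite ler_pdivlMr // mulrC; apply: (le_trans (norm2_le _ x k1 k2)).
rewrite N12 -/N; apply: ler_wpM2l; first by rewrite !addr_ge0 ?cnorm_ge0.
by lra.
Qed.

End Polystability.

(** * One-parameter subgroups *)

Section OneParameterSubgroups.
Variables (R : realType) (n : nat).
Local Notation C := (R[i])%C.
Implicit Types x : 'I_n -> C.

(** [A] shifts x_k0 to 0 and then scales the coordinates by t^-e and t^e. [B] has weight t^-p on the
    indices with eigenvalue x_k0 and t^q on the others; the equation between [p] and [q] says that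
    its determinant is 1. *)
Lemma one_parameter_act x k0 (t : C) e p q : t != 0 ->
    (p * multiplicity x k0 = q * (n - multiplicity x k0))%N ->
  exists A B, inG A B 1%:M /\ act A B 1%:M (pencil_state x) =
    (diag_mx (\row_k (if x k == x k0 then 0 else t ^+ q / t ^+ e * (x k - x k0))),
     diag_mx (\row_k (if x k == x k0 then t ^+ e / t ^+ p else t ^+ q * t ^+ e))).
Proof.
move=> t0 pq; have te := expf_neq0 e t0; have tp := expf_neq0 p t0.
pose A : 'M[C]_2 := \matrix_(i, j)
  if i == 0 then if j == 0 then (t ^+ e)^-1 else - x k0 / t ^+ e
  else if j == 0 then 0 else t ^+ e.
have [A00 A01 A10 A11] : [/\ A 0 0 = (t ^+ e)^-1, A 0 1 = - x k0 / t ^+ e,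
    A 1 0 = 0 & A 1 1 = t ^+ e] by split; rewrite mxE.
pose b k := if x k == x k0 then (t ^+ p)^-1 else t ^+ q.
exists A, (diag_mx (\row_k b k)); split.
  split; [|split; last exact: det1].
    by rewrite mx22_det A00 A01 A10 A11; field.
  rewrite det_diag (eq_bigr b) => [|k _]; last by rewrite mxE.
  rewrite (bigID (fun k => x k == x k0)) /=.
  rewrite (eq_bigr (fun=> (t ^+ p)^-1)) => [|k xk]; last by rewrite /b xk.
  rewrite [X in _ * X](eq_bigr (fun=> t ^+ q)) => [|k xk]; last by rewrite /b (negPf xk).
  rewrite !prodr_const.
  have cm := card_multiplicity x k0; have cm' := card_neq_multiplicity x k0.
  by rewrite cm cm' exprVn -!exprM pq mulVf // expf_neq0.
rewrite act_pencil trmx1 !mulmx1.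
congr pair; rewrite mul_diag_mx; apply/matrixP => i j; rewrite !mxE mulrnAr;
  congr (_ *+ _).
  rewrite /b /root_vec1 A00 A01; case: eqP => [->|_]; last by ring.
  by ring.
by rewrite /b /root_vec2 A10 A11 mul0r add0r; case: eqP => // _; rewrite mulrC.
Qed.

Lemma small_parameter (d K : R) : 0 < d -> 0 <= K ->
  exists t : R, 0 < t <= 1 /\ t * (1 + K) <= d.
Proof.
move=> d0 K0; have K1 : 0 < 1 + K by rewrite ltr_wpDr.
exists (Num.min 1 (d / (1 + K))); rewrite lt_min ltr01 divr_gt0 //=.
by rewrite ge_min lexx; split=> //; rewrite -ler_pdivlMr // ge_min lexx orbT.
Qed.

Lemma cnormX (t : R) k : 0 <= t -> cnorm (t%:C%C ^+ k) = t ^+ k.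
Proof. by move=> t0; rewrite -rmorphXn cnormR // exprn_ge0. Qed.

Lemma cnorm_diag_le (d : R) (f g : 'I_n -> C) i j : 0 <= d ->
    (forall k, cnorm (f k - g k) <= d) ->
  cnorm (diag_mx (\row_k f k) i j - diag_mx (\row_k g k) i j) <= d.
Proof.
move=> d0 fg; rewrite !mxE; have [_|_] := eqVneq i j; first by rewrite !mulr1n.
by rewrite !mulr0n subrr cnorm0.
Qed.

Lemma sum_cnorm_ge x k0 k : cnorm (x k - x k0) <= \sum_j cnorm (x j - x k0).
Proof. by rewrite (bigD1 k) //= lerDl sumr_ge0 // => j _; rewrite cnorm_ge0. Qed.

Lemma nullcone_pencil x k0 : (n < (multiplicity x k0).*2)%N ->
  nullcone (pencil_state x).
Proof.
set m := multiplicity x k0 => nm; apply/in_orbit_closureP => d d0.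
pose K := \sum_j cnorm (x j - x k0).
have K0 : 0 <= K by rewrite sumr_ge0 // => j _; rewrite cnorm_ge0.
have [t [/andP[t0 t1] tK]] := small_parameter d0 K0.
have t01 : 0 <= t <= 1 by rewrite ltW.
have tC : t%:C%C != 0 by rewrite -cnorm_eq0 cnormR ?gt_eqF // ltW.
have mn : (m <= n)%N by rewrite -[X in (_ <= X)%N]card_ord max_card.
(* With these weights the diagonal entries carry the powers t^(2m - n) and t^(2m + n), all positive
   because 2m > n. *)
have [A [B [g actE]]] := @one_parameter_act x k0 t%:C%C n (2 * (n - m)) (2 * m) tC
  ltac:(rewrite -/m; lia).
exists A, B, 1%:M; split=> // i j; rewrite actE.
have td : t <= d by apply: le_trans tK; rewrite ler_peMr ?(ltW t0) // lerDl.
have z1 : (zero_state R n).1 = diag_mx (\row_k 0) 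
    by apply/matrixP => k l; rewrite !mxE mul0rn.
 
have z2 : (zero_state R n).2 = diag_mx (\row_k 0) by rewrite -z1.
have pw k : (0 < k)%N -> t ^+ k <= t by apply: expr_le_id.
split; [rewrite z1|rewrite z2]; apply: cnorm_diag_le => [|k]; rewrite ?(ltW d0) // subr0.
  case: ifP => _; first by rewrite cnorm0 ltW.
  have -> : t%:C%C ^+ (2 * m) / t%:C%C ^+ n = t%:C%C ^+ (2 * m - n).
    have -> : (2 * m = (2 * m - n) + n)%N by lia.
    by rewrite exprD mulfK ?expf_neq0 // addnK.
  rewrite cnormM cnormX ?(ltW t0) //; apply: le_trans tK.
  apply: ler_pM; rewrite ?exprn_ge0 ?cnorm_ge0 ?(ltW t0) //.
    by apply: pw; lia.
  by apply: (le_trans (sum_cnorm_ge x k0 k)); rewrite lerDr.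
case: ifP => _; last first.
  by rewrite -exprD cnormX ?(ltW t0) //; apply: le_trans td; apply: pw; lia.
have -> : t%:C%C ^+ n / t%:C%C ^+ (2 * (n - m)) = t%:C%C ^+ (n - 2 * (n - m)).
  have -> : t%:C%C ^+ n = t%:C%C ^+ (n - 2 * (n - m)) * t%:C%C ^+ (2 * (n - m)).
    by rewrite -exprD; congr (_ ^+ _); lia.
  by rewrite mulfK ?expf_neq0.
by rewrite cnormX ?(ltW t0) //; apply: le_trans td; apply: pw; lia.
Qed.

(** The limit as t tends to 0 of [one_parameter_act] with e = p = q = 1: the first matrix is
    constant, the second has entries 1 and t^2. *)
Definition degenerate_state x k0 : state R n :=
  (diag_mx (\row_k (x k - x k0)), diag_mx (\row_k (if x k == x k0 then 1 else 0))).

Lemma degenerate_in_closure x k0 : (multiplicity x k0).*2 = n ->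
  in_orbit_closure (pencil_state x) (degenerate_state x k0).
Proof.
set m := multiplicity x k0 => nm; apply/in_orbit_closureP => d d0.
have [t [/andP[t0 t1] tK]] := small_parameter d0 (lexx (0 : R)).
have t01 : 0 <= t <= 1 by rewrite ltW.
have tC : t%:C%C != 0 by rewrite -cnorm_eq0 cnormR ?gt_eqF // ltW.
have [A [B [g actE]]] := @one_parameter_act x k0 t%:C%C 1 1 1 tC
  ltac:(rewrite -/m; lia).
exists A, B, 1%:M; split=> // i j; rewrite actE.
have td : t <= d by apply: le_trans tK; rewrite ler_peMr ?(ltW t0) // lerDl.
split; apply: cnorm_diag_le => [|k]; rewrite ?(ltW d0) // !expr1 divff // ?mul1r.
  by case: eqP => [->|_]; rewrite subrr ?subr0 cnorm0 ltW.
case: eqP => _; first by rewrite subrr cnorm0 ltW.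
rewrite subr0 -expr2 cnormX ?(ltW t0) //; apply: le_trans td.
exact: expr_le_id.
Qed.

(* The determinant form of the limit has only two roots, that of the pencil at
   least three. *)
Lemma degenerate_notin_orbit x k0 k1 k2 k3 :
    x k1 != x k2 -> x k1 != x k3 -> x k2 != x k3 ->
  ~ Defs.in_orbit (pencil_state x) (degenerate_state x k0).
Proof.
move=> n12 n13 n23 [A [B [D [g]]]]; rewrite act_pencil => -[e1 e2].
have [detA _] := g.
have rdet k j : x k - x j =
    root_vec1 A x k * root_vec2 A x j - root_vec2 A x k * root_vec1 A x j.
  by rewrite -[LHS]mulr1 -detA mx22_det /root_vec1 /root_vec2; ring.
(* The form of the degenerate state is evaluated at the point where the j-th linear factor of the
   transformed pencil vanishes. *)
have prod0 j : \prod_k (root_vec2 A x j * (x k - x k0) +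
    - root_vec1 A x j * (if x k == x k0 then 1 else 0)) = 0.
  have diagE (f h : 'I_n -> C) (a b : C) :
      \det (a *: diag_mx (\row_k f k) + b *: diag_mx (\row_k h k)) =
      \prod_k (a * f k + b * h k).
    rewrite (_ : _ + _ = diag_mx (\row_k (a * f k + b * h k))).
      by rewrite det_diag; apply: eq_bigr => k _; rewrite mxE.
    apply/matrixP => p q; rewrite !mxE.
    by case: (p == q); rewrite ?mulr1n ?mulr0n ?mulr0 ?addr0.
  rewrite -diagE -e1 -e2 mulmx_comb !det_mulmx diagE.
  rewrite (_ : \prod_k _ = 0) ?mulr0 ?mul0r // (bigD1 j) //=.
  by rewrite [X in X * _](_ : _ = 0) ?mul0r //; ring.
have null j : root_vec1 A x j = 0 \/ root_vec2 A x j = 0.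
  have /eqP/prodf_eq0[k _] := prod0 j.
  have [->|nk] := eqVneq (x k) (x k0).
    by rewrite subrr mulr0 add0r mulr1 oppr_eq0 => /eqP; left.
  rewrite mulr0 addr0 mulf_eq0 subr_eq0 (negPf nk) orbF => /eqP; by right.
have neq1 k j : x k != x j -> root_vec1 A x k = 0 -> root_vec1 A x j = 0 -> False.
  by move=> /negP + e f; apply; rewrite -subr_eq0 rdet e f mul0r mulr0 subrr.
have neq2 k j : x k != x j -> root_vec2 A x k = 0 -> root_vec2 A x j = 0 -> False.
  by move=> /negP + e f; apply; rewrite -subr_eq0 rdet e f mul0r mulr0 subrr.
(* Pigeonhole: three root vectors lie on two coordinate axes, so two of them are parallel, although
   their eigenvalues differ. *)
case: (null k1) (null k2) (null k3) => a [] b [] c;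
  by [apply: (neq1 _ _ n12) | apply: (neq1 _ _ n13) | apply: (neq1 _ _ n23)
     | apply: (neq2 _ _ n12) | apply: (neq2 _ _ n13) | apply: (neq2 _ _ n23)].
Qed.

End OneParameterSubgroups.

(** * Distinct eigenvalues and their sorted multiplicities *)

Section Multiplicities.
Variables (R : realType) (n : nat).
Local Notation C := (R[i])%C.
Variable x : 'I_n -> C.

Let counts := [seq #|[set k | x k == v]| | v <- eigvals x].

Lemma perm_mults : perm_eq (mults x) counts.
Proof. by rewrite /mults perm_sort. Qed.

Lemma size_mults : size (mults x) = size (eigvals x).
Proof. by rewrite (perm_size perm_mults) size_map. Qed.

Lemma mem_eigvals v : (v \in eigvals x) = [exists k, x k == v].
Proof.
rewrite mem_undup; apply/mapP/existsP => [[k _ ->]|[k /eqP <-]]; exists k => //.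
by rewrite mem_enum.
Qed.

(** Double counting: each index belongs to exactly one eigenvalue. *)
Lemma sumn_mults : sumn (mults x) = n.
Proof.
rewrite (perm_sumn perm_mults) sumnE big_map.
under eq_bigr do rewrite -sum1_card.
rewrite (exchange_big_dep predT) //=.
rewrite (eq_bigr (fun=> 1%N)) ?sum1_card ?card_ord // => k _.
rewrite (eq_bigl (fun v => v == x k)); last by move=> v; rewrite inE eq_sym.
rewrite sum1_count; apply/eqP; rewrite eqn_leq -has_count count_uniq_mem ?undup_uniq //.
by rewrite leq_b1 has_pred1 mem_eigvals; apply/existsP; exists k.
Qed.

Lemma head_mults_sum : (0 < size (mults x))%N ->
  (head 0%N (mults x) + sumn (behead (mults x)) = n)%N.
Proof. by have := sumn_mults; case: (mults x). Qed.

Lemma multiplicity_le_head k : (multiplicity x k <= head 0 (mults x))%N.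
Proof.
have : multiplicity x k \in mults x.
  rewrite (perm_mem perm_mults); apply: map_f.
  by rewrite mem_eigvals; apply/existsP; exists k.
have : sorted geq (mults x) by apply: sort_sorted => a b; apply: leq_total.
case: (mults x) => //= a s /(order_path_min (rev_trans leq_trans))/allP le_a.
by rewrite inE => /predU1P[->|/le_a].
Qed.

Lemma head_mults_attained : (0 < size (mults x))%N ->
  exists k, multiplicity x k = head 0%N (mults x).
Proof.
move=> s0; have : head 0%N (mults x) \in mults x.
  by case: (mults x) s0 => //= a s _; rewrite mem_head.
rewrite (perm_mem perm_mults) => /mapP[v]; rewrite mem_eigvals => /existsP[k /eqP <-] ->.
by exists k.
Qed.

Lemma nth_eigvals j : (j < size (eigvals x))%N -> exists k, x k = nth 0 (eigvals x) j.
Proof.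
by move/(mem_nth 0); rewrite mem_eigvals => /existsP[k /eqP]; exists k.
Qed.

Lemma nth_eigvals_neq i j : (i < j < size (eigvals x))%N ->
  nth 0 (eigvals x) i != nth 0 (eigvals x) j.
Proof.
by case/andP=> ij js; rewrite nth_uniq ?undup_uniq ?neq_ltn ?ij // (ltn_trans ij).
Qed.

Lemma size_eigvals_le : (size (eigvals x) <= n)%N.
Proof. by rewrite (leq_trans (size_undup _)) // size_map size_enum_ord. Qed.

Lemma size_eigvals_inj : size (eigvals x) = n <-> injective x.
Proof.
split=> [E|xinj].
  apply/injectiveP; rewrite /injectiveb /dinjectiveb.
  have := ltn_size_undup [seq x k | k <- enum 'I_n].
  rewrite -/(eigvals x) E size_map size_enum_ord ltnn => /esym/negbFE.
  by [].
have u : uniq [seq x k | k <- enum 'I_n] by rewrite map_inj_uniq ?enum_uniq.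
by rewrite /eigvals undup_id // size_map size_enum_ord.
Qed.

End Multiplicities.

(** * Stability *)

Section ProjectiveDimension.
Variables (R : realType) (n : nat).
Local Notation C := (R[i])%C.

Lemma proj_orbit_dimE (s : state R n) : proj_orbit_dim s = (\rank (tangent_mx s)).-1.
Proof. by rewrite rank_tangentE. Qed.

End ProjectiveDimension.

Section Stability.
Variables (R : realType) (n : nat).
Local Notation C := (R[i])%C.
Implicit Types x : 'I_n.+1 -> C.

Lemma rank_state_bound (s : state R n.+1) :
  (\rank (tangent_mx s) + n.+2 <= 2 * 2 + (n.+1 * n.+1 + n.+1 * n.+1))%N.
Proof. exact: rank_tangent_bound. Qed.

Lemma stable_of_rank (s : state R n.+1) : polystable s ->
    (forall phi : state R n.+1, (\rank (tangent_mx phi) <= \rank (tangent_mx s))%N) ->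
  stable s.
Proof.
move=> ps rk; split=> // phi _; rewrite !proj_orbit_dimE.
by have := rk phi; lia.
Qed.

Lemma rank_tangent_pencil_inj x : injective x -> (2 < n.+1)%N ->
  (2 * 2 + (n.+1 * n.+1 + n.+1 * n.+1) <=
     \rank (tangent_mx (pencil_state x)) + n.+2)%N.
Proof.
move=> xinj n3.
have n1 : (1 < n.+1)%N by lia.
have n0 : (0 < n.+1)%N by lia.
exact: (@rank_pencil_inj _ _ x (Ordinal n0) (Ordinal n1) (Ordinal n3) xinj).
Qed.

(** With three or more distinct eigenvalues the stabilizer attains the universal lower bound of
    [rank_state_bound]. *)
Lemma stable_pencil_inj x : injective x -> (2 < n.+1)%N ->
  polystable (pencil_state x) -> stable (pencil_state x).
Proof.
move=> xinj n3 ps; apply: (stable_of_rank ps) => phi.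
have := rank_tangent_pencil_inj xinj n3; have := rank_state_bound phi.
lia.
Qed.

Lemma multiplicity_inj x k : injective x -> multiplicity x k = 1%N.
Proof.
move=> xinj; rewrite /multiplicity (_ : [set j | _] = [set k]) ?cards1 //.
by apply/setP => j; rewrite !inE (inj_eq xinj).
Qed.

(** The pencil with eigenvalues 0, ..., n is polystable and has a larger orbit. *)
Lemma unstable_pencil_noninj x (i j : 'I_n.+1) : (2 < n.+1)%N ->
  i != j -> x i = x j -> ~ stable (pencil_state x).
Proof.
move=> n3 nij xij [_ max_dim].
pose y (k : 'I_n.+1) : C := k%:R.
have yinj : injective y by move=> k l /eqP; rewrite eqr_nat => /eqP/val_inj.
have ps : polystable (pencil_state y).
  apply: polystable_pencil => [|k]; last by rewrite multiplicity_inj.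
  by exists i, j; rewrite (inj_eq yinj).
have := max_dim _ ps; rewrite !proj_orbit_dimE.
have := rank_tangent_pencil_inj yinj n3.
have : (\rank (tangent_mx (pencil_state x)) + n.+3 <=
    2 * 2 + (n.+1 * n.+1 + n.+1 * n.+1))%N := rank_pencil_noninj nij xij.
(* Keeps the larger rank above 1, so that the predecessor in [proj_orbit_dim] preserves the strict
   inequality. *)
have : (n.+1 * 2 < n.+1 * n.+1)%N by rewrite ltn_pmul2l.
lia.
Qed.

(** For 2 x 2 pencils the tangent map is onto: its rank is at least 12 - 4 = 8, the dimension of the
    whole space. *)
Lemma stable_pencil2 x (i j : 'I_n.+1) : n.+1 = 2%N -> i != j -> injective x ->
  polystable (pencil_state x) -> stable (pencil_state x).
Proof.
move=> n2 nij xinj ps; apply: (stable_of_rank ps) => phi.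
have := rank_leq_col (tangent_mx phi).
have : (2 * 2 + (n.+1 * n.+1 + n.+1 * n.+1) <=
    \rank (tangent_mx (pencil_state x)) + n.+3)%N := rank_pencil_inj2 n2 xinj nij.
have : (n.+1 * n.+1 = 4)%N by rewrite n2.
lia.
Qed.

Lemma noninjectiveP x : (size (eigvals x) < n.+1)%N ->
  exists i j, i != j /\ x i = x j.
Proof.
move=> lt_n; apply: contrapT => none; have xinj : injective x.
  move=> i j xij; apply/eqP; apply: contrapT => /negP nij.
  by apply: none; exists i, j.
by move: lt_n; rewrite (size_eigvals_inj x).2 // ltnn.
Qed.

End Stability.

Theorem theorem4 (R : realType) (n : nat) (x : 'I_n -> R[i]%C) :
  (2 <= n)%N ->
  let l := size (mults x) in
  let m1 := head 0%N (mults x) in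
  let m2 := nth 0%N (mults x) 1 in
  let rest := sumn (behead (mults x)) in
  let psi := pencil_state x in
  (2 <= l)%N ->
  [/\ (rest < m1)%N -> nullcone psi,
      l = 2%N -> m1 = m2 ->
        (n = 2%N -> stable psi) /\ (n <> 2%N -> strictly_polystable psi),
      (2 < l)%N -> m1 = rest -> strictly_semistable psi
    & (2 < l)%N -> (m1 < rest)%N ->
        [/\ polystable psi, stable psi <-> l = n & strictly_polystable psi <-> (l < n)%N]].
Proof.
case: n x => [//|n] x n2 l m1 m2 rest psi l2.
have l0 : (0 < l)%N by lia.
have msum : (m1 + rest = n.+1)%N := head_mults_sum l0.
have mult_le k : (multiplicity x k <= m1)%N := multiplicity_le_head x k.
have [kmax mult_max] := head_mults_attained l0; rewrite -/m1 in mult_max.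
have lE : l = size (eigvals x) := size_mults x.
have l_le : (l <= n.+1)%N by rewrite lE size_eigvals_le.
have [k1 xk1] : exists k, x k = nth 0 (eigvals x) 0 by apply: nth_eigvals; lia.
have [k2 xk2] : exists k, x k = nth 0 (eigvals x) 1 by apply: nth_eigvals; lia.
have n12 : x k1 != x k2 by rewrite xk1 xk2 nth_eigvals_neq //; lia.
have dist : exists k j, x k != x j by exists k1, k2.
split=> [lt_rest|l_eq m12|l3 m_rest|l3 lt_rest].
- by apply: (@nullcone_pencil _ _ x kmax); rewrite mult_max; lia.
- have rest2 : rest = m2.
    rewrite /rest /m2; move: l_eq; rewrite /l.
    by case: (mults x) => [|? [|? []]] //= _; rewrite addn0.
  have two k : x k = x k1 \/ x k = x k2.
    have : x k \in eigvals x by rewrite mem_eigvals; apply/existsP; exists k.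
    rewrite xk1 xk2; move: lE; rewrite l_eq.
    by case: (eigvals x) => [|? [|? []]] //= _; rewrite !inE => /orP[]/eqP; auto.
  (* Both multiplicities are at most [m1], which is half of n + 1, so covering all indices forces
     equality. *)
  have mult12 : (n.+1 <= multiplicity x k1 + multiplicity x k2)%N.
    rewrite -[X in (X <= _)%N]card_ord -cardsT; apply: leq_trans (leq_card_setU _ _).
    apply: subset_leq_card; apply/fintype.subsetP => k _; rewrite !inE.
    by case: (two k) => ->; rewrite eqxx ?orbT.
  have mult k : (multiplicity x k).*2 = n.+1.
    have := mult_le k1; have := mult_le k2.
    have : multiplicity x k = multiplicity x k1 \/ multiplicity x k = multiplicity x k2.
      by case: (two k) => xk; [left|right]; rewrite /multiplicity xk.
    by case=> ->; lia.
  have ps : polystable psi by apply: (polystable_two_roots n12).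
  split=> [n_eq|n_neq].
    apply: (@stable_pencil2 _ _ x k1 k2) => //.
      by apply: contraNneq n12 => ->.
    by apply/size_eigvals_inj; rewrite -lE l_eq n_eq.
  split=> //; have [|i [j [nij xij]]] := @noninjectiveP _ _ x; first by lia.
  by apply: unstable_pencil_noninj nij xij; lia.
- have [k3 xk3] : exists k, x k = nth 0 (eigvals x) 2 by apply: nth_eigvals; lia.
  split.
    by apply: semistable_pencil => // k; have := mult_le k; lia.
  (* A closed orbit would contain the degenerate limit at the eigenvalue of largest multiplicity. *)
  move=> [_ closed]; apply: (@degenerate_notin_orbit _ _ x kmax k1 k2 k3) => //.
  + by rewrite xk1 xk3 nth_eigvals_neq //; lia.
  + by rewrite xk2 xk3 nth_eigvals_neq //; lia.
  apply: closed; apply: degenerate_in_closure; rewrite mult_max; lia.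
- have ps : polystable psi.
    by apply: polystable_pencil => // k; have := mult_le k; lia.
  have stableE : stable psi <-> l = n.+1.
    split=> [st|l_eq].
      apply/eqP; rewrite eqn_leq l_le leqNgt; apply/negP => lt_l.
      have [|i [j [nij xij]]] := @noninjectiveP _ _ x; first by rewrite -lE.
      by apply: (unstable_pencil_noninj _ nij xij st); lia.
    apply: stable_pencil_inj => //; last by lia.
    by apply/size_eigvals_inj; rewrite -lE.
  split=> //; split=> [[_ nst]|lt_l].
    rewrite ltn_neqAle l_le andbT; apply/eqP => l_eq.
    by apply: nst; apply/stableE.
  by split=> // /stableE l_eq; move: lt_l; rewrite l_eq ltnn.
Qed.
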